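(* Let $\pi\in\mathcal{P}_0$ be a given policy, $\pi_k(\cdot|x)=\mathcal{N}(P_kx,\Sigma_{\pi_k})$, such that $\mathbb{P}^\pi\in\Pi(\Sigma_{\mathrm{ini}},\Sigma_{\mathrm{fin}})$. Then an optimal solution of $$\min_{\mathbb{Q}^\rho\in\Pi(\mathcal{R}_0)}\ \mathcal{D}_{\mathrm{KL}}[\mathbb{P}^\pi\|\mathbb{Q}^\rho]+\mathbb{E}_{\mathbb{P}^\pi}[V(x_0,\dots,x_T)]$$ (the generalized Schrödinger bridge problem with fixed controlled process distribution $\mathbb{P}^\pi$) is given by $\mathbb{Q}^{\rho^\pi}$, where $\rho^\pi=\{\rho_k^\pi\}_{k=0}^{T-1}$, $\rho_k^\pi=\mathcal{N}(0,\Sigma_{\pi_k}+P_k\Sigma_{x_k}P_k^\top)$, and $\Sigma_{x_{k+1}}=(A_k+B_kP_k)\Sigma_{x_k}(A_k+B_kP_k)^\top+B_k\Sigma_{\pi_k}B_k^\top$ for $k\in\{0,\dots,T-1\}$ with $\Sigma_{x_0}=\Sigma_{\mathrm{ini}}$. In addition, if $B_k$ has full column rank for every $k\in\{0,\dots,T-1\}$, then the optimal solution $\mathbb{Q}^{\rho^\pi}$ is unique.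
   Context: Notation. $T\ge1$ is an integer, $A_k\in\mathbb{R}^{n\times n}$, $B_k\in\mathbb{R}^{n\times m}$ for $k\in\{0,\dots,T-1\}$; $\Sigma_{\mathrm{ini}},\Sigma_{\mathrm{fin}},\Sigma_{\mathrm{ref}}\succ0$ are $n\times n$; $\mu_{\mathrm{ref}}\in\mathbb{R}^n$. $\mathcal{N}(\mu,\Sigma)$ is the Gaussian distribution, $\mathcal{D}_{\mathrm{KL}}$ the Kullback–Leibler divergence, $B^\dagger$ the Moore–Penrose inverse, $\|x\|_M:=(x^\top Mx)^{1/2}$, $\mathrm{Im}$ the image of a matrix, $\mathbb{E}_{\mathbb{P}}$ the expectation under $\mathbb{P}$. $\chi:=(\mathbb{R}^n)^{T+1}$. Classes. $\mathcal{R}_0:=\{\rho=\{\rho_k\}_{k=0}^{T-1}\mid\rho_k=\mathcal{N}(0,\Sigma_{\rho_k}),\ \Sigma_{\rho_k}\succ0\}$, with $\rho_k$ distributions on $\mathbb{R}^m$; $$\mathcal{P}_0:=\{\pi=\{\pi_k\}_{k=0}^{T-1}\mid\pi_k(\cdot|x)=\mathcal{N}(P_kx,\Sigma_{\pi_k}),\ P_k\in\mathbb{R}^{m\times n},\ \Sigma_{\pi_k}\succ0,\ \mathrm{Im}(P_k)\subset\mathrm{Im}(\Sigma_{\pi_k})\}.$$ Reference process. For $\rho\in\mathcal{R}_0$, $\mathbb{Q}^\rho$ is the law on $\chi$ of $\{x_k\}_{k=0}^T$ given by $x_{k+1}=A_kx_k+B_kw_k^\rho$, $w_k^\rho\sim\rho_k$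 (independent noise), $x_0\sim\mathcal{N}(\mu_{\mathrm{ref}},\Sigma_{\mathrm{ref}})$. $\Pi(\mathcal{R}_0):=\{\mathbb{Q}^\rho\mid\rho\in\mathcal{R}_0\}$. Controlled process. For a policy $\pi$, $\mathbb{P}^\pi$ is the law on $\chi$ of $x_{k+1}=A_kx_k+B_ku_k$, $u_k\sim\pi_k(\cdot|x_k)$, $x_0\sim\mathcal{N}(0,\Sigma_{\mathrm{ini}})$. $\Pi(\Sigma_{\mathrm{ini}},\Sigma_{\mathrm{fin}})$ is the set of probability distributions on $\chi$ whose marginals at $k=0$ and $k=T$ are $\mathcal{N}(0,\Sigma_{\mathrm{ini}})$ and $\mathcal{N}(0,\Sigma_{\mathrm{fin}})$. Potential. $V(x_0,\dots,x_T):=\sum_{k=0}^{T-1}\tfrac12\|x_{k+1}-A_kx_k\|^2_{B_k^{\dagger\top}B_k^\dagger}$. *)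

(* Defs.v *)
From HB Require Import structures.
From mathcomp Require Import all_boot all_order all_algebra.
From mathcomp Require Import all_classical all_reals all_analysis measurable_realfun giry.

Set Implicit Arguments.
Unset Strict Implicit.
Unset Printing Implicit Defensive.

Import Order.TTheory GRing.Theory Num.Theory.
Import numFieldNormedType.Exports.

Local Open Scope classical_set_scope.
Local Open Scope ring_scope.

Definition colvec_display : measure_display.
Proof. exact: default_measure_display. Qed.

Section colvec_measurable.
Context (R : realType) (n : nat).

Definition colvec_coor (i : 'I_n) (v : 'cV[R]_n) : R := v i ord0.

Let colvec_set0 : g_sigma_preimage colvec_coor set0.
Proof. exact: sigma_algebra0. Qed.

Let colvec_setC A :
  g_sigma_preimage colvec_coor A -> g_sigma_preimage colvec_coor (~` A).
Proof. exact: sigma_algebraC. Qed.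

Let colvec_bigcup (F : (set 'cV[R]_n)^nat) :
  (forall i, g_sigma_preimage colvec_coor (F i)) ->
  g_sigma_preimage colvec_coor (\bigcup_i F i).
Proof. exact: sigma_algebra_bigcup. Qed.

(* The product (= Borel) sigma-algebra, generated by the coordinates. *)
HB.instance Definition _ := @isMeasurable.Build colvec_display
  'cV[R]_n (g_sigma_preimage colvec_coor) colvec_set0 colvec_setC colvec_bigcup.

Lemma measurable_colvec_coor (i : 'I_n) :
  measurable_fun [set: 'cV[R]_n] (colvec_coor i).
Proof.
move=> _ Y mY; rewrite setTI; apply: sub_sigma_algebra => /=.
rewrite -bigcup_seq/=; exists i => /=; first by rewrite mem_index_enum.
by exists Y => //; rewrite setTI.
Qed.

Lemma measurable_fun_colvecP d (T : measurableType d) (f : T -> 'cV[R]_n) :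
  (forall i, measurable_fun [set: T] (fun t => f t i ord0)) ->
  measurable_fun [set: T] f.
Proof.
move=> mf.
apply: (measurability (\big[setU/set0]_(i < n)
  preimage_set_system setT (colvec_coor i) measurable)) => //.
move=> _ /= [B + <-]; rewrite -bigcup_seq/= => -[i _ [C mC <-]].
by rewrite !setTI -comp_preimage -[X in measurable X]setTI; exact: mf.
Qed.

End colvec_measurable.

Section gaussian.
Context (R : realType).

Definition cons_colvec n (xv : measurableTypeR R * 'cV[R]_n) : 'cV[R]_n.+1 :=
  col_mx (const_mx (xv.1 : R) : 'cV[R]_1) xv.2.

Lemma measurable_cons_colvec n : measurable_fun setT (@cons_colvec n).
Proof.
apply: measurable_fun_colvecP => i; rewrite /cons_colvec.
case: (@split_ordP 1 n i) => j ->.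
  rewrite (_ : (fun _ => _) = fst)//; apply/funext => t.
  by rewrite [LHS]col_mxEu mxE.
rewrite (_ : (fun _ => _) = colvec_coor j \o snd).
  exact: (measurableT_comp (measurable_colvec_coor j)).
by apply/funext => t; rewrite [LHS]col_mxEd.
Qed.

HB.instance Definition _ n := isMeasurableFun.Build _ _ _ _ (@cons_colvec n)
  (@measurable_cons_colvec n).

(* The law of [n] independent standard normal variables. *)
Fixpoint std_gaussian n : probability 'cV[R]_n R :=
  match n with
  | 0 => \d_(0 : 'cV[R]_0)
  | n'.+1 => distribution (normal_prob 0 1 \x std_gaussian n')%E (@cons_colvec n')
  end.

Definition affine_map n (mu : 'cV[R]_n) (L : 'M[R]_n) (z : 'cV[R]_n) : 'cV[R]_n :=
  mu + L *m z.

Lemma measurable_mulmx m n (M : 'M[R]_(m, n)) :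
  measurable_fun [set: 'cV[R]_n] (mulmx M).
Proof.
apply: measurable_fun_colvecP => i.
under eq_fun do rewrite mxE.
apply: measurable_sum => j; apply: measurable_funM => //.
exact: measurable_colvec_coor.
Qed.

Lemma measurable_addcv n d (T : measurableType d) (f g : T -> 'cV[R]_n) :
  measurable_fun setT f -> measurable_fun setT g ->
  measurable_fun setT (fun t => f t + g t).
Proof.
move=> mf mg; apply: measurable_fun_colvecP => i.
under eq_fun do rewrite mxE.
by apply: measurable_funD;
  exact: (measurableT_comp (measurable_colvec_coor i)).
Qed.

Lemma measurable_affine_map n (mu : 'cV[R]_n) (L : 'M[R]_n) :
  measurable_fun setT (affine_map mu L).
Proof. by apply: measurable_addcv => //; exact: measurable_mulmx. Qed.

HB.instance Definition _ n (mu : 'cV[R]_n) (L : 'M[R]_n) :=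
  isMeasurableFun.Build _ _ _ _ (affine_map mu L) (@measurable_affine_map n mu L).

(* A matrix [L] with [L L^T = S]; one exists iff [S] is symmetric positive
   semidefinite (junk value [0] otherwise). *)
Definition cov_factor n (S : 'M[R]_n) : 'M[R]_n :=
  xget 0 [set L : 'M[R]_n | L *m L^T = S].

(* [N(mu, S)] is the law of [mu + L z], with [z] standard normal and
   [L L^T = S]; this law does not depend on the choice of [L]. *)
Definition gaussian n (mu : 'cV[R]_n) (S : 'M[R]_n) : probability 'cV[R]_n R :=
  distribution (std_gaussian n) (affine_map mu (cov_factor S)).

Definition posdef n (S : 'M[R]_n) : Prop :=
  S^T = S /\ forall x : 'cV[R]_n, x != 0 -> 0 < (x^T *m S *m x) 0 0.

End gaussian.

Section semidirect.
Context d d' (X : measurableType d) (Y : measurableType d') (R : realType).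
Variables (P : probability X R) (K : R.-pker X ~> Y).
Local Open Scope ereal_scope.

(* The joint law of [(x, y)] when [x ~ P] and [y | x ~ K x]. *)
Definition semidirect (A : set (X * Y)) : \bar R := \int[P]_x K x (xsection A x).

Let mK A : measurable A -> measurable_fun setT (fun x => K x (xsection A x)).
Proof. by move=> mA; apply: measurable_fun_xsection_finite_kernel; rewrite inE. Qed.

Let semidirect0 : semidirect set0 = 0.
Proof. by apply: integral0_eq => x _; rewrite xsection0 measure0. Qed.

Let semidirect_ge0 A : 0 <= semidirect A.
Proof. exact: integral_ge0. Qed.

Let semidirect_sigma_additive : semi_sigma_additive semidirect.
Proof.
move=> F mF tF mUF.
rewrite [X in _ --> X](_ : _ = \sum_(n <oo) semidirect (F n)).
  by apply/cvg_closeP; split; [apply: is_cvg_nneseries|rewrite closeE].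
rewrite -integral_nneseries//; last by move=> n; exact: mK.
apply: eq_integral => x _; apply/esym/cvg_lim => //=; rewrite xsection_bigcup.
apply: (measure_sigma_additive _ (trivIset_xsection tF)) => ?.
exact: measurable_xsection.
Qed.

HB.instance Definition _ := isMeasure.Build _ _ _ semidirect
  semidirect0 semidirect_ge0 semidirect_sigma_additive.

Let semidirectT : semidirect setT = 1.
Proof.
rewrite /semidirect; under eq_integral.
  by move=> x _; rewrite xsectionE preimage_setT prob_kernel; over.
by rewrite integral_cst// mul1e; exact: probability_setT.
Qed.

HB.instance Definition _ := Measure_isProbability.Build _ _ _ semidirect semidirectT.

End semidirect.

Section kernel_precomposition.
Context d1 d2 d3 (X1 : measurableType d1) (X2 : measurableType d2)
  (Y : measurableType d3) (R : realType).
Variables (f : {mfun X1 >-> X2}) (K : R.-pker X2 ~> Y).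

Definition kprecomp : X1 -> {measure set Y -> \bar R} := K \o f.

Let measurable_kprecomp U : measurable U -> measurable_fun setT (kprecomp ^~ U).
Proof.
by move=> mU; apply: (measurableT_comp (measurable_kernel K U mU)).
Qed.

HB.instance Definition _ :=
  @isKernel.Build _ _ X1 Y R kprecomp measurable_kprecomp.

Let kprecomp_prob x : kprecomp x setT = 1%E.
Proof. exact: prob_kernel. Qed.

HB.instance Definition _ :=
  @Kernel_isProbability.Build _ _ X1 Y R kprecomp kprecomp_prob.

End kernel_precomposition.

Section trajectories.
Context (R : realType) (n m : nat).

Definition last_state k (xs : k.+1.-tuple 'cV[R]_n) : 'cV[R]_n :=
  tnth xs ord_max.

Lemma measurable_last_state k : measurable_fun setT (@last_state k).
Proof. exact: measurable_tnth. Qed.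

HB.instance Definition _ k := isMeasurableFun.Build _ _ _ _ (@last_state k)
  (@measurable_last_state k).

Definition initial_path (x : 'cV[R]_n) : 1.-tuple 'cV[R]_n := [tuple x].

Lemma measurable_initial_path : measurable_fun setT initial_path.
Proof. by apply/measurable_fun_tnthP => i; rewrite ord1 (_ : _ \o _ = id)//. Qed.

HB.instance Definition _ := isMeasurableFun.Build _ _ _ _ initial_path
  measurable_initial_path.

Definition extend_path (A : 'M[R]_n) (B : 'M[R]_(n, m)) k
    (xu : k.+1.-tuple 'cV[R]_n * 'cV[R]_m) : k.+2.-tuple 'cV[R]_n :=
  [tuple of rcons xu.1 (A *m last_state xu.1 + B *m xu.2)].

Lemma measurable_extend_path A B k : measurable_fun setT (@extend_path A B k).
Proof.
apply/measurable_fun_tnthP => i.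
have [ik|ik] := ltnP i k.+1.
  rewrite (_ : _ \o _ = (fun xs => tnth xs (Ordinal ik)) \o fst).
    exact: (measurableT_comp (measurable_tnth _)).
  apply/funext => -[xs u] /=; rewrite (tnth_nth 0) (tnth_nth 0)/= nth_rcons.
  by rewrite size_tuple ik.
rewrite (_ : _ \o _ = fun xu => A *m last_state xu.1 + B *m xu.2).
  apply: measurable_addcv.
    apply: (measurableT_comp (measurable_mulmx A)).
    exact: (measurableT_comp (@measurable_last_state k)).
  exact: (measurableT_comp (measurable_mulmx B)).
apply/funext => -[xs u] /=; rewrite (tnth_nth 0)/= nth_rcons size_tuple.
have ->: i = k.+1 :> nat by apply/eqP; rewrite eqn_leq ik -ltnS ltn_ord.
by rewrite ltnn eqxx.
Qed.

HB.instance Definition _ A B k := isMeasurableFun.Build _ _ _ _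
  (@extend_path A B k) (@measurable_extend_path A B k).

Variables (A : nat -> 'M[R]_n) (B : nat -> 'M[R]_(n, m)).

(* The law of [(x_0, ..., x_T)] for [x_0 ~ init] and
   [x_{k+1} = A_k x_k + B_k u_k], where, conditionally on [x_0, ..., x_k],
   [u_k ~ K k x_k]. *)
Fixpoint path_law (init : probability 'cV[R]_n R)
    (K : nat -> R.-pker 'cV[R]_n ~> 'cV[R]_m) (T : nat) :
    probability (T.+1.-tuple 'cV[R]_n) R :=
  match T with
  | 0 => distribution init initial_path
  | T'.+1 =>
    distribution (semidirect (path_law init K T') (kprecomp (@last_state T') (K T')))
      (@extend_path (A T') (B T') T')
  end.

End trajectories.

Definition KL d (X : measurableType d) (R : realType) (P Q : probability X R) :
    \bar R :=
  if `[< P `<< Q >]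
  then (\int[P]_x lne (Radon_Nikodym (charge_of_finite_measure P) Q x))%E
  else +oo%E.

Section bridge.
Context (R : realType) (n m : nat).

(* The Moore-Penrose inverse, as the unique matrix satisfying the four Penrose
   conditions; the library's [pinvmx] is only some generalized inverse. *)
Definition is_MPinverse p q (M : 'M[R]_(p, q)) (X : 'M[R]_(q, p)) : Prop :=
  [/\ M *m X *m M = M, X *m M *m X = X,
      (M *m X)^T = M *m X & (X *m M)^T = X *m M].

Definition MPinverse p q (M : 'M[R]_(p, q)) : 'M[R]_(q, p) :=
  xget 0 [set X | is_MPinverse M X].

Definition wnorm p (M : 'M[R]_p) (x : 'cV[R]_p) : R :=
  Num.sqrt ((x^T *m M *m x) 0 0).

Variables (T : nat) (A : nat -> 'M[R]_n) (B : nat -> 'M[R]_(n, m)).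

Definition traj : Type := T.+1.-tuple 'cV[R]_n.
HB.instance Definition _ := Measurable.on traj.

Definition state (k : nat) (x : traj) : 'cV[R]_n := nth 0 x k.

Definition potential (x : traj) : R :=
  \sum_(0 <= k < T) 2^-1 *
    wnorm ((MPinverse (B k))^T *m MPinverse (B k))
      (state k.+1 x - A k *m state k x) ^+ 2.

(* Sequences indexed by the stages [k = 0, ..., T-1] are represented by functions
   on [nat] of which only the first [T] values are constrained. *)
Definition noise := nat -> probability 'cV[R]_m R.
Definition policy := nat -> R.-pker 'cV[R]_n ~> 'cV[R]_m.

Definition calR0 : set noise := [set rho |
  forall k, (k < T)%N -> exists S : 'M[R]_m, posdef S /\ rho k ≡μ gaussian 0 S].

(* [pi] belongs to the class [P_0], with gains [P_k] and covariances [S_k]. *)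
Definition in_calP0 (P : nat -> 'M[R]_(m, n)) (S : nat -> 'M[R]_m)
    (pi : policy) : Prop :=
  forall k, (k < T)%N ->
    [/\ forall x : 'cV[R]_n, pi k x ≡μ gaussian (P k *m x) (S k),
        posdef (S k)
      & [set P k *m x | x in [set: 'cV[R]_n]] `<=`
        [set S k *m y | y in [set: 'cV[R]_m]]].

(* The noise of the reference process is a state-independent policy; in
   particular [w_k] is independent of [x_0, w_0, ..., w_(k-1)]. *)
Definition open_loop (rho : noise) : policy := fun k =>
  kprobability (measurable_cst (rho k : pprobability 'cV[R]_m R)).

Definition refLaw (mu_ref : 'cV[R]_n) (S_ref : 'M[R]_n) (rho : noise) :
    probability traj R :=
  path_law A B (gaussian mu_ref S_ref) (open_loop rho) T.

Definition ctrlLaw (S_ini : 'M[R]_n) (pi : policy) : probability traj R :=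
  path_law A B (gaussian 0 S_ini) pi T.

Definition refLaws (mu_ref : 'cV[R]_n) (S_ref : 'M[R]_n) :
    set (probability traj R) :=
  [set Q : probability traj R | exists2 rho, calR0 rho & Q ≡μ refLaw mu_ref S_ref rho].

Definition couplings (S_ini S_fin : 'M[R]_n) : set (probability traj R) :=
  [set P : probability traj R | forall U, measurable U ->
     pushforward P (state 0) U = gaussian 0 S_ini U /\
     pushforward P (state T) U = gaussian 0 S_fin U].

Definition cost (P Q : probability traj R) : \bar R :=
  (KL P Q + 'E_P[potential])%E.

Definition optimal (mu_ref : 'cV[R]_n) (S_ref : 'M[R]_n)
    (P Q : probability traj R) : Prop :=
  refLaws mu_ref S_ref Q /\
  forall Q', refLaws mu_ref S_ref Q' -> (cost P Q <= cost P Q')%E.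

Fixpoint state_cov (S_ini : 'M[R]_n) (P : nat -> 'M[R]_(m, n))
    (S : nat -> 'M[R]_m) (k : nat) : 'M[R]_n :=
  match k with
  | 0 => S_ini
  | k'.+1 => (A k' + B k' *m P k') *m state_cov S_ini P S k'
               *m (A k' + B k' *m P k')^T + B k' *m S k' *m (B k')^T
  end.

Definition rho_pi (S_ini : 'M[R]_n) (P : nat -> 'M[R]_(m, n))
    (S : nat -> 'M[R]_m) : noise := fun k =>
  gaussian 0 (S k + P k *m state_cov S_ini P S k *m (P k)^T).

End bridge.

(* Main.v *)
(** Disintegrate both path laws along the increments [y_k = x_{k+1} - A_k x_k]: the
    likelihood ratio of [P^pi] with respect to [Q^rho] is the product of the ratio of the
    initial laws and of one ratio [d(B_k# pi_k(.|x_k)) / d(B_k# rho_k)(y_k)] per stage, so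
    that
      [KL(P^pi | Q^rho) - KL(P^pi | Q^(rho^pi)) =
       sum_k E_(P^pi)[log d(B_k# rho^pi_k) / d(B_k# rho_k) (y_k)]].
    Under [P^pi] the input [u_k] has law [rho^pi_k], hence each term of the sum is the
    relative entropy of [B_k# rho^pi_k] with respect to [B_k# rho_k]: it is nonnegative, and
    if it vanishes the two laws coincide. Since [Q^rho] depends on [rho] through the laws
    [B_k# rho_k] only, this gives optimality and uniqueness. All log-densities are quadratic
    and all states are linear images of standard Gaussians, so everything is integrable. *)
Require Import Defs.
From mathcomp Require Import all_boot all_order all_algebra.
From mathcomp Require Import all_classical all_reals all_analysis measurable_realfun giry.
From mathcomp Require Import ring lra.

Set Implicit Arguments.
Unset Strict Implicit.
Unset Printing Implicit Defensive.

Import Order.TTheory GRing.Theory Num.Theory.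
Import numFieldNormedType.Exports.

Local Open Scope classical_set_scope.
Local Open Scope ring_scope.

(** * Integrals against densities and kernels *)

(** The matrices [B_k] may be rank deficient, so the law of [B_k u] can live on a proper subspace
    and have no Lebesgue density. It is compared instead with the image of a standard Gaussian on
    ['cV_(\rank B)], a reference common to all noises because positive definite covariances give
    full support in the column space. Standard Gaussians also stand in for multivariate Lebesgue
    measure: reweighting by [expR (sqnorm x / 2)] restores a translation-invariant integral, and
    Gaussian elimination gives linear changes of variables up to an unspecified positive factor. No
    determinant is computed; where a constant has to be controlled, total mass one does it.
    Identities between laws are stated for nonnegative measurable test functions, where Tonelli and
    monotone convergence need no integrability. Second moments enter only later, to split and
    recombine log-ratios and to cancel finite terms of the cost in the extended reals. *)

Section integral_characterization.
Context d (T : measurableType d) (R : realType).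
Local Open Scope ereal_scope.
Variables (mu : {measure set T -> \bar R}) (I : (T -> \bar R) -> \bar R).
Hypothesis I_indic : forall A, measurable A -> I (fun x => (\1_A x)%:E) = mu A.
Hypothesis I_add : forall f g, measurable_fun setT f -> measurable_fun setT g ->
  (forall x, 0 <= f x) -> (forall x, 0 <= g x) -> I (f \+ g) = I f + I g.
Hypothesis I_scale : forall (c : R) f, measurable_fun setT f ->
  (forall x, 0 <= f x) -> (0 <= c)%R -> I (fun x => c%:E * f x) = c%:E * I f.
Hypothesis I_lim : forall f : (T -> \bar R)^nat,
  (forall n, measurable_fun setT (f n)) -> (forall n x, 0 <= f n x) ->
  (forall x, nondecreasing_seq (f ^~ x)) ->
  I (fun x => limn (f ^~ x)) = limn (fun n => I (f n)).

Import HBNNSimple.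

Let I_sum (s : seq R) (g : R -> T -> \bar R) :
  (forall r, measurable_fun setT (g r)) -> (forall r x, 0 <= g r x) ->
  I (fun x => \sum_(r <- s) g r x) = \sum_(r <- s) I (g r).
Proof.
move=> mg g0; elim: s => [|r s ih].
  (* The value of [I] at the zero function is read off from the indicator of the empty set. *)
  rewrite big_nil (_ : (fun _ => _) = (fun x => (\1_set0 x)%:E)).
    by rewrite I_indic// measure0.
  by apply/funext => x; rewrite big_nil indic0.
rewrite big_cons -ih -I_add//.
- by congr I; apply/funext => x; rewrite big_cons.
- exact: emeasurable_sum.
- by move=> x; exact: sume_ge0.
Qed.

(** Indicators, then simple functions, then monotone limits. The four hypotheses isolate what this
    argument uses, so that densities and kernels share one proof. *)
Lemma ge0_integral_unique (f : T -> \bar R) : measurable_fun setT f ->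
  (forall x, 0 <= f x) -> \int[mu]_x f x = I f.
Proof.
move=> mf f0; pose f_ := nnsfun_approx measurableT mf.
have f_lim x : limn (fun n => (f_ n x)%:E) = f x.
  by apply/cvg_lim => //; exact: cvg_nnsfun_approx.
have mf_ n : measurable_fun setT (fun x => (f_ n x)%:E) by exact/measurable_EFinP.
have f_ge0 n x : 0 <= (f_ n x)%:E by rewrite lee_fin.
have f_nd x : nondecreasing_seq (fun n => (f_ n x)%:E).
  by move=> a b ab; rewrite lee_fin; exact/lefP/nd_nnsfun_approx.
transitivity (\int[mu]_x limn (fun n => (f_ n x)%:E)).
  by apply: eq_integral => x _; rewrite f_lim.
rewrite monotone_convergence//.
transitivity (I (fun x => limn (fun n => (f_ n x)%:E))); last first.
  by congr I; apply/funext => x; rewrite f_lim.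
rewrite (I_lim mf_)//; apply: congr_lim; apply/funext => n.
rewrite integralT_nnsfun sintegralE.
rewrite fsbig_finite//=.
(* [I_sum] needs the summands to be nonnegative for every [r], not only in the range *)
transitivity (I (fun x => \sum_(r <- finmap.enum_fset (fset_set (range (f_ n))))
    (`|r|%R%:E * (\1_(f_ n @^-1` [set r]) x)%:E))).
  rewrite I_sum; last 2 first.
  - by move=> r; apply: measurable_funeM; exact/measurable_EFinP.
  - by move=> r x; rewrite mule_ge0// lee_fin.
  rewrite big_seq [RHS]big_seq; apply: eq_bigr => r.
  rewrite in_fset_set// inE => -[x _ <-].
  by rewrite I_scale// ?I_indic ?ger0_norm//; exact/measurable_EFinP.
congr I; apply/funext => x.
rewrite fimfunE -fsumEFin// fsbig_finite//=.
rewrite big_seq [RHS]big_seq; apply: eq_bigr => r.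
by rewrite in_fset_set// inE => -[y _ <-]; rewrite EFinM ger0_norm.
Qed.

End integral_characterization.

Section density.
Context d (T : measurableType d) (R : realType).
Local Open Scope ereal_scope.

Lemma ge0_integral_density (mu nu : {measure set T -> \bar R}) (h : T -> R) :
  measurable_fun setT h -> (forall x, 0 <= h x)%R ->
  (forall A, measurable A -> nu A = \int[mu]_(x in A) (h x)%:E) ->
  forall f, measurable_fun setT f -> (forall x, 0 <= f x) ->
  \int[nu]_x f x = \int[mu]_x (f x * (h x)%:E).
Proof.
move=> /measurable_EFinP mh h0 nuE; apply: ge0_integral_unique.
- move=> A mA; rewrite nuE// [RHS]integral_mkcond.
  apply: eq_integral => x _; rewrite patchE indicE.
  by case: ifPn => xA; rewrite ?mul1e// mul0e.
- move=> f g mf mg f0 g0; rewrite -ge0_integralD//.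
  + by apply: eq_integral => x _; rewrite ge0_muleDl.
  + by move=> x _; rewrite mule_ge0// lee_fin.
  + exact: emeasurable_funM.
  + by move=> x _; rewrite mule_ge0// lee_fin.
  + exact: emeasurable_funM.
- move=> c f mf f0 c0; rewrite -ge0_integralZl//.
  + by apply: eq_integral => x _; rewrite muleA.
  + exact: emeasurable_funM.
  + by move=> x _; rewrite mule_ge0// lee_fin.
- move=> f mf f0 ndf; rewrite -monotone_convergence//.
  + apply: eq_integral => x _; rewrite limeMr//.
    exact: ereal_nondecreasing_is_cvgn.
  + by move=> n; exact: emeasurable_funM.
  + by move=> n x _; rewrite mule_ge0// lee_fin.
  + by move=> x _ a b ab; rewrite lee_wpmul2r ?lee_fin//; exact: ndf.
Qed.

End density.

Section semidirect_integral.
Context d d' (X : measurableType d) (Y : measurableType d') (R : realType).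
Variables (P : probability X R) (K : R.-pker X ~> Y).
Local Open Scope ereal_scope.

Lemma measurable_integral_pker (f : X * Y -> \bar R) :
  measurable_fun setT f -> (forall z, 0 <= f z) ->
  measurable_fun setT (fun x => \int[K x]_y f (x, y)).
Proof.
by move=> mf f0; exact: measurable_fun_integral_finite_kernel.
Qed.

Lemma ge0_integral_semidirect (f : X * Y -> \bar R) :
  measurable_fun setT f -> (forall z, 0 <= f z) ->
  \int[semidirect P K]_z f z = \int[P]_x \int[K x]_y f (x, y).
Proof.
have mpair (g : X * Y -> \bar R) x : measurable_fun setT g ->
    measurable_fun setT (fun y => g (x, y)).
  by move=> mg; apply: (measurableT_comp mg); exact: measurable_pair1.
move: f; apply: (ge0_integral_unique (I := fun f => \int[P]_x \int[K x]_y f (x, y))).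
- move=> A mA; apply: eq_integral => x _.
  rewrite -(setIT (xsection A x)) -integral_indic//; last first.
    exact: measurable_xsection.
  apply: eq_integral => y _; rewrite !indicE; congr (_ %:R%:E).
  by rewrite mem_xsection.
- move=> f g mf mg f0 g0; rewrite -ge0_integralD//.
  + by apply: eq_integral => x _; rewrite ge0_integralD//; exact: mpair.
  + by move=> x _; exact: integral_ge0.
  + exact: measurable_integral_pker.
  + by move=> x _; exact: integral_ge0.
  + exact: measurable_integral_pker.
- move=> c f mf f0 c0; rewrite -ge0_integralZl//.
  + by apply: eq_integral => x _; rewrite ge0_integralZl//; exact: mpair.
  + exact: measurable_integral_pker.
  + by move=> x _; exact: integral_ge0.
- move=> f mf f0 ndf; rewrite -monotone_convergence//.
  + apply: eq_integral => x _; rewrite -monotone_convergence//.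
      by move=> n; exact: mpair.
  + by move=> n; exact: measurable_integral_pker.
  + by move=> n x _; exact: integral_ge0.
  + move=> x _ a b ab; apply: ge0_le_integral => //.
    * exact: mpair.
    * exact: mpair.
    * by move=> y _; exact: ndf.
Qed.

End semidirect_integral.

(** * Lebesgue integration through the standard Gaussian *)

Section lebesgue_affine.
Context (R : realType).
Local Open Scope ereal_scope.
Notation mu := (@lebesgue_measure R).

(** Lebesgue measure is determined by its values on half-open intervals, and the preimage of such an
    interval is again one, shortened by the factor [a]. *)
Let affine_pos (a b : R) (A : set R) : (0 < a)%R -> measurable A ->
  mu A = a%:E * pushforward mu ((fun x => a * x + b)%R : measurableTypeR R -> measurableTypeR R) A.
Proof.
move=> a0 mA; pose g : measurableTypeR R -> measurableTypeR R := (fun x => a * x + b)%R.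
have mg : measurable_fun setT g.
  by apply: measurable_funD => //; exact: measurable_funM.
pose nu := mscale (NngNum (ltW a0)) (pushforward mu g).
rewrite -[RHS]/(nu mg A); apply: lebesgue_measure_unique => // _ [[c d]] _ <-.
transitivity (a%:E * mu (g @^-1` `]c, d]%classic)); last by [].
have -> : g @^-1` `]c, d]%classic = `]((c - b) / a)%R, ((d - b) / a)%R]%classic.
  apply/seteqP; split => x/=; rewrite !in_itv/= /g
    ltr_pdivrMr// ler_pdivlMr// ltrBlDr lerBrDr mulrC//.
rewrite !lebesgue_measure_itv/= !lte_fin ltr_pM2r ?invr_gt0// ltrD2r.
case: ifPn => _; last by rewrite mule0.
by rewrite -!EFinB -EFinM; congr EFin; field; rewrite gt_eqF.
Qed.

Lemma ge0_integral_lebesgue_affine (a b : R) (f : R -> \bar R) : (a != 0)%R ->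
  measurable_fun setT f -> (forall x, 0 <= f x) ->
  \int[mu]_x f (a * x + b)%R = `|a|^-1%:E * \int[mu]_x f x.
Proof.
move=> aneq0 mf f0.
(* A negative slope is reduced to a positive one by reflection, which preserves Lebesgue measure. *)
wlog a0 : a f aneq0 mf f0 / (0 < a)%R.
  move=> H; have [a0|a0|] := ltrgtP a 0%R; last by move/eqP; rewrite (negbTE aneq0).
    have := H (- a)%R f; rewrite oppr_eq0 oppr_gt0 normrN => <-//.
    pose g x := f (- a * x + b)%R.
    have mg : measurable_fun setT g.
      apply: (measurableT_comp mf).
      by apply: measurable_funD => //; exact: measurable_funM.
    transitivity (\int[pushforward mu (-%R : _ -> measurableTypeR R)]_x g x).
      rewrite ge0_integral_pushforward//.
      - by rewrite preimage_setT; apply: eq_integral => x _ /=; rewrite /g mulrNN.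
      - by move=> x _; exact: f0.
    by apply: eq_measure_integral => A mA _; exact: lebesgue_measureN.
  exact: H.
have -> : \int[mu]_x f x = a%:E * \int[mu]_x f (a * x + b)%R; last first.
  by rewrite muleA -EFinM gtr0_norm// mulVf// mul1e.
pose g : measurableTypeR R -> measurableTypeR R := (fun x => a * x + b)%R.
have mg : measurable_fun setT g.
  by apply: measurable_funD => //; exact: measurable_funM.
pose nu := mscale (NngNum (ltW a0)) (pushforward mu g).
rewrite (eq_measure_integral (nu mg)); last first.
  by move=> A mA _; exact: (affine_pos b a0).
rewrite ge0_integral_mscale//=; congr (_ * _).
by rewrite ge0_integral_pushforward// preimage_setT.
Qed.

End lebesgue_affine.

Section std_gaussian_lebesgue.
Context (R : realType).
Local Open Scope ereal_scope.

Definition sqnorm n (x : 'cV[R]_n) : R := (x^T *m x)%R ord0 ord0.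

Lemma sqnormE n (x : 'cV[R]_n) : sqnorm x = (\sum_i x i ord0 ^+ 2)%R.
Proof. by rewrite /sqnorm mxE; apply: eq_bigr => i _; rewrite !mxE expr2. Qed.

Lemma sqnorm_col_mx n1 n2 (u : 'cV[R]_n1) (v : 'cV[R]_n2) :
  sqnorm (col_mx u v) = (sqnorm u + sqnorm v)%R.
Proof. by rewrite /sqnorm tr_col_mx mul_row_col mxE. Qed.

Lemma measurable_bilin d (T : measurableType d) p q (M : 'M[R]_(p, q))
    (f : T -> 'cV[R]_p) (g : T -> 'cV[R]_q) :
  measurable_fun setT f -> measurable_fun setT g ->
  measurable_fun setT (fun t => ((f t)^T *m M *m g t)%R ord0 ord0).
Proof.
move=> mf mg; under eq_fun do rewrite -mulmxA mxE.
apply: measurable_sum => i; apply: measurable_funM.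
  under eq_fun do rewrite mxE.
  exact: (measurableT_comp (measurable_colvec_coor i) mf).
exact: (measurableT_comp (measurable_colvec_coor i) (measurableT_comp (measurable_mulmx M) mg)).
Qed.

Lemma measurable_sqnorm n : measurable_fun setT (@sqnorm n).
Proof.
rewrite (_ : @sqnorm n = fun x => (x^T *m 1%:M *m x)%R ord0 ord0); first exact: measurable_bilin.
by apply/funext => x; rewrite mulmx1.
Qed.

(* Lebesgue integration on ['cV_n], up to a constant factor, written as an integral
   against a probability measure so that Tonelli applies directly. *)
Definition flat_weight n (x : 'cV[R]_n) : \bar R := (expR (sqnorm x / 2))%:E.

Definition flat_int n (f : 'cV[R]_n -> \bar R) : \bar R :=
  \int[std_gaussian R n]_x (f x * flat_weight x).

Lemma measurable_flat_weight n : measurable_fun setT (@flat_weight n).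
Proof.
apply/measurable_EFinP; apply: measurableT_comp => //.
by apply: measurable_funM => //; exact: measurable_sqnorm.
Qed.

Lemma flat_weight_ge0 n (x : 'cV[R]_n) : 0 <= flat_weight x.
Proof. by rewrite lee_fin expR_ge0. Qed.

Lemma flat_weight_col_mx n1 n2 (u : 'cV[R]_n1) (v : 'cV[R]_n2) :
  flat_weight (col_mx u v) = flat_weight u * flat_weight v.
Proof. by rewrite /flat_weight sqnorm_col_mx mulrDl expRD EFinM. Qed.

Lemma measurable_fun_mule_flat_weight n (f : 'cV[R]_n -> \bar R) :
  measurable_fun setT f -> measurable_fun setT (fun x => f x * flat_weight x).
Proof. by move=> mf; apply: emeasurable_funM => //; exact: measurable_flat_weight. Qed.

Lemma flat_int_ge0 n (f : 'cV[R]_n -> \bar R) : (forall x, 0 <= f x) -> 0 <= flat_int f.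
Proof. by move=> f0; apply: integral_ge0 => x _; rewrite mule_ge0// flat_weight_ge0. Qed.

Lemma flat_intZ n (k : R) (f : 'cV[R]_n -> \bar R) : (0 <= k)%R ->
  measurable_fun setT f -> (forall x, 0 <= f x) ->
  flat_int (fun x => k%:E * f x) = k%:E * flat_int f.
Proof.
move=> k0 mf f0; rewrite /flat_int -ge0_integralZl//.
- by apply: eq_integral => x _; rewrite muleA.
- exact: measurable_fun_mule_flat_weight.
- by move=> x _; rewrite mule_ge0// flat_weight_ge0.
Qed.

Definition flat_int1 (f : R -> \bar R) : \bar R :=
  \int[normal_prob 0 1]_x (f x * (expR (x ^+ 2 / 2))%:E).

(** The weight cancels the exponential in the standard normal density and leaves only the peak
    value. *)
Lemma flat_int1E (f : R -> \bar R) : measurable_fun setT f -> (forall x, 0 <= f x) ->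
  flat_int1 f = (normal_peak (1 : R))%:E * \int[lebesgue_measure]_x f x.
Proof.
move=> mf f0; rewrite -ge0_integralZl//; last by rewrite lee_fin normal_peak_ge0.
rewrite /flat_int1 (ge0_integral_density (mu := @lebesgue_measure R) (nu := normal_prob 0 1)
  (h := normal_pdf 0 1))//.
- apply: eq_integral => x _; rewrite -muleA -EFinM muleC; congr (_%:E * _).
  rewrite normal_pdfE ?oner_eq0// /normal_fun.
  by rewrite mulrCA -expRD subr0 expr1n mulNr subrr expR0 mulr1.
- exact: measurable_normal_pdf.
- by move=> x; exact: normal_pdf_ge0.
- apply: emeasurable_funM => //; apply/measurable_EFinP.
  apply: measurableT_comp => //; apply: measurable_funM => //.
- by move=> x; rewrite mule_ge0// lee_fin expR_ge0.
Qed.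

Lemma flat_int1_affine (a b : R) (f : R -> \bar R) : (a != 0)%R ->
  measurable_fun setT f -> (forall x, 0 <= f x) ->
  flat_int1 (fun x => f (a * x + b)%R) = `|a|^-1%:E * flat_int1 f.
Proof.
move=> a0 mf f0; rewrite !flat_int1E//; last first.
  apply: (measurableT_comp mf).
  by apply: measurable_funD => //; exact: measurable_funM.
by rewrite ge0_integral_lebesgue_affine// muleCA.
Qed.

Lemma ge0_integral_std_gaussianS n (f : 'cV[R]_n.+1 -> \bar R) :
  measurable_fun setT f -> (forall x, 0 <= f x) ->
  \int[std_gaussian R n.+1]_x f x =
  \int[normal_prob 0 1]_x \int[std_gaussian R n]_v f (cons_colvec (x, v)).
Proof.
move=> mf f0; rewrite [LHS]ge0_integral_distribution//.
have mfc : measurable_fun setT (f \o @cons_colvec R n) by exact: measurableT_comp.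
by rewrite fubini_tonelli1// => x; exact: f0.
Qed.

Lemma std_gaussianS_swap n (f : 'cV[R]_n.+1 -> \bar R) :
  measurable_fun setT f -> (forall x, 0 <= f x) ->
  \int[std_gaussian R n.+1]_x f x =
  \int[std_gaussian R n]_v \int[normal_prob 0 1]_x f (cons_colvec (x, v)).
Proof.
move=> mf f0; rewrite ge0_integral_std_gaussianS//.
have mfc : measurable_fun setT (f \o @cons_colvec R n) by exact: measurableT_comp.
apply: (@fubini_tonelli _ _ _ _ _ (normal_prob 0 1) (std_gaussian R n)
  (f \o @cons_colvec R n)) => //.
by move=> x; exact: f0.
Qed.

Lemma flat_weight_cons n (x : R) (v : 'cV[R]_n) :
  flat_weight (cons_colvec (x, v)) = (expR (x ^+ 2 / 2))%:E * flat_weight v.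
Proof.
rewrite [LHS](@flat_weight_col_mx 1 n); congr (_ * _).
by rewrite /flat_weight sqnormE big_ord1 mxE.
Qed.

Lemma measurable_cons_colvecl n (x : R) :
  measurable_fun setT (fun v : 'cV[R]_n => cons_colvec (x : measurableTypeR R, v)).
Proof. exact: (measurableT_comp (@measurable_cons_colvec R n) (measurable_pair1 _)). Qed.

Lemma measurable_cons_colvecr n (v : 'cV[R]_n) :
  measurable_fun setT (fun x : measurableTypeR R => cons_colvec (x, v)).
Proof. exact: (measurableT_comp (@measurable_cons_colvec R n) (measurable_pair2 _)). Qed.

Lemma flat_intS n (f : 'cV[R]_n.+1 -> \bar R) :
  measurable_fun setT f -> (forall x, 0 <= f x) ->
  flat_int f = flat_int1 (fun x => flat_int (fun v => f (cons_colvec (x, v)))).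
Proof.
move=> mf f0; rewrite /flat_int ge0_integral_std_gaussianS; last 2 first.
- exact: measurable_fun_mule_flat_weight.
- by move=> x; rewrite mule_ge0// flat_weight_ge0.
apply: eq_integral => x _; rewrite -ge0_integralZr.
- by apply: eq_integral => v _; rewrite flat_weight_cons -muleA (muleC (flat_weight v)).
- exact: measurableT.
- apply: measurable_fun_mule_flat_weight.
  exact: (measurableT_comp mf (measurable_cons_colvecl x)).
- by move=> v _; rewrite mule_ge0// flat_weight_ge0.
- by rewrite lee_fin expR_ge0.
Qed.

(** With the first coordinate integrated innermost, an upper block triangular map acts on it by an
    affine map of the line. *)
Lemma flat_intS_swap n (f : 'cV[R]_n.+1 -> \bar R) :
  measurable_fun setT f -> (forall x, 0 <= f x) ->
  flat_int f = flat_int (fun v => flat_int1 (fun x => f (cons_colvec (x, v)))).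
Proof.
move=> mf f0; rewrite /flat_int std_gaussianS_swap; last 2 first.
- exact: measurable_fun_mule_flat_weight.
- by move=> x; rewrite mule_ge0// flat_weight_ge0.
apply: eq_integral => v _; rewrite -ge0_integralZr.
- by apply: eq_integral => x _; rewrite flat_weight_cons muleA.
- exact: measurableT.
- apply: emeasurable_funM; last first.
    apply/measurable_EFinP; apply: measurableT_comp => //.
    by apply: measurable_funM => //; exact: measurable_funX.
  exact: (measurableT_comp mf (measurable_cons_colvecr v)).
- by move=> x _; rewrite mule_ge0// lee_fin expR_ge0.
- exact: flat_weight_ge0.
Qed.

Lemma measurable_flat_int_cons n (f : 'cV[R]_n.+1 -> \bar R) :
  measurable_fun setT f -> (forall x, 0 <= f x) ->
  measurable_fun setT (fun x : measurableTypeR R => flat_int (fun v => f (cons_colvec (x, v)))).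
Proof.
move=> mf f0.
pose g (z : measurableTypeR R * 'cV[R]_n) := f (cons_colvec z) * flat_weight z.2.
have mg : measurable_fun setT g.
  apply: emeasurable_funM; first exact: measurableT_comp.
  exact: (measurableT_comp (@measurable_flat_weight n)).
have g0 z : 0 <= g z by rewrite mule_ge0// flat_weight_ge0.
exact: (@measurable_fun_fubini_tonelli_F _ _ _ _ _ (std_gaussian R n) g mg g0).
Qed.

Lemma measurable_flat_int1_cons n (f : 'cV[R]_n.+1 -> \bar R) :
  measurable_fun setT f -> (forall x, 0 <= f x) ->
  measurable_fun setT (fun v => flat_int1 (fun x => f (cons_colvec (x, v)))).
Proof.
move=> mf f0.
pose g (z : measurableTypeR R * 'cV[R]_n) := f (cons_colvec z) * (expR (z.1 ^+ 2 / 2))%:E.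
have mg : measurable_fun setT g.
  apply: emeasurable_funM; first exact: measurableT_comp.
  apply/measurable_EFinP; apply: measurableT_comp => //.
  by apply: measurable_funM => //; exact: measurable_funX.
have g0 z : 0 <= g z by rewrite mule_ge0// lee_fin expR_ge0.
exact: (@measurable_fun_fubini_tonelli_G _ _ _ _ _ (normal_prob 0 1) g mg g0).
Qed.

Lemma flat_int1_ge0 (f : R -> \bar R) : (forall x, 0 <= f x) -> 0 <= flat_int1 f.
Proof. by move=> f0; apply: integral_ge0 => x _; rewrite mule_ge0// lee_fin expR_ge0. Qed.

Lemma cons_colvecD n (x y : R) (u v : 'cV[R]_n) :
  (cons_colvec (x, u) + cons_colvec (y, v))%R = cons_colvec ((x + y)%R, (u + v)%R) :> 'cV[R]_n.+1.
Proof.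
rewrite [LHS](@add_col_mx _ 1 n); apply: (f_equal2 (@col_mx R 1 n 1)) => //.
by apply/matrixP => i j; rewrite !mxE.
Qed.

Lemma colvec_consP n (z : 'cV[R]_n.+1) : exists x v, z = cons_colvec (x, v).
Proof.
exists ((usubmx (z : 'cV[R]_(1 + n))) ord0 ord0), (dsubmx (z : 'cV[R]_(1 + n))).
rewrite -[LHS](@vsubmxK _ 1 n); apply: (f_equal2 (@col_mx R 1 n 1)) => //.
by apply/matrixP => i j; rewrite !ord1 !mxE.
Qed.

(** Coordinate by coordinate, a translation is the affine change of variables of slope one. *)
Lemma flat_int_translate n (a : 'cV[R]_n) (f : 'cV[R]_n -> \bar R) :
  measurable_fun setT f -> (forall x, 0 <= f x) ->
  flat_int (fun x => f (a + x)%R) = flat_int f.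
Proof.
elim: n a f => [|n ih] a f mf f0.
  by congr flat_int; apply/funext => x; rewrite (flatmx0 (a + x)%R) (flatmx0 x).
have mfa : measurable_fun setT (fun x => f (a + x)%R).
  by apply: (measurableT_comp mf); exact: measurable_addcv.
have [x0 [v0 aE]] := colvec_consP a.
rewrite (flat_intS mf f0) (flat_intS mfa (fun x => f0 (a + x)%R)).
(* The factor one is written as the inverse absolute value of the slope, to match
   [flat_int1_affine]. *)
rewrite -[RHS]mul1e -(invr1) -(normr1 R).
rewrite -(flat_int1_affine x0 (oner_neq0 _) (measurable_flat_int_cons mf f0)); last first.
  by move=> x; exact: flat_int_ge0.
congr flat_int1; apply/funext => x.
rewrite -[RHS](ih v0); last 2 first.
- exact: (measurableT_comp mf (measurable_cons_colvecl _)).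
- by move=> v; exact: f0.
by congr flat_int; apply/funext => v; rewrite aE cons_colvecD mul1r (addrC x).
Qed.

(* [M] multiplies Lebesgue measure by a constant factor. *)
Definition flat_scaling n (M : 'M[R]_n) := exists2 c : R, (0 < c)%R &
  forall f, measurable_fun setT f -> (forall x, 0 <= f x) ->
  flat_int (fun x => f (M *m x)%R) = c%:E * flat_int f.

Lemma flat_scalingM n (M N : 'M[R]_n) :
  flat_scaling M -> flat_scaling N -> flat_scaling (M *m N)%R.
Proof.
move=> [c c0 cE] [c' c'0 c'E]; exists (c * c')%R; first exact: mulr_gt0.
move=> f mf f0; rewrite mulrC EFinM -muleA -cE// -c'E//.
  by congr flat_int; apply/funext => x; rewrite mulmxA.
exact: (measurableT_comp mf (measurable_mulmx _)).
Qed.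

Lemma mul_block_cons n (a : R) (b : 'rV[R]_n) (c : 'cV[R]_n) (D : 'M[R]_n) (x : R) (v : 'cV[R]_n) :
  ((block_mx a%:M b c D : 'M[R]_(1 + n)) *m (cons_colvec (x, v) : 'cV[R]_(1 + n)))%R =
  cons_colvec ((a * x + (b *m v) ord0 ord0)%R, (x *: c + D *m v)%R).
Proof.
rewrite [LHS](@mul_block_col _ 1 n 1 n); apply: (f_equal2 (@col_mx R 1 n 1)).
  apply/matrixP => i j; rewrite !ord1 [LHS]mxE [RHS]mxE/=; congr (_ + _)%R.
  by rewrite mul_scalar_mx !mxE.
rewrite /=; congr (_ + _)%R; apply/matrixP => i j; rewrite !ord1 !mxE big_ord1 !mxE.
by rewrite mulrC.
Qed.

End std_gaussian_lebesgue.

(** * Linear changes of variables by Gaussian elimination *)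

Section linear_change_of_variables.
Context (R : realType).
Local Open Scope ereal_scope.

(** For a fixed lower part [v], the first coordinate undergoes the affine map of slope [a] and
    intercept [b *m v]; what remains after integrating it depends on [D *m v] only. *)
Lemma flat_scaling_upper n (a : R) (b : 'rV[R]_n) (D : 'M[R]_n) : (a != 0)%R ->
  flat_scaling D -> flat_scaling (block_mx a%:M b 0 D : 'M[R]_(1 + n)).
Proof.
move=> a0 [c c0 cE]; exists (`|a|^-1 * c)%R.
  by rewrite mulr_gt0// invr_gt0 normr_gt0.
move=> f mf f0; have mG := measurable_flat_int1_cons mf f0.
set N := block_mx _ _ _ _.
have mfN : measurable_fun setT (fun x => f (N *m x)%R).
  exact: (measurableT_comp mf (measurable_mulmx _)).
rewrite (flat_intS_swap mf f0) (flat_intS_swap mfN (fun x => f0 (N *m x)%R)).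
have G0 v : 0 <= flat_int1 (fun x => f (cons_colvec (x, v))) by exact: flat_int1_ge0.
have a1 : (0 <= `|a|^-1)%R by rewrite invr_ge0.
rewrite EFinM -muleA -(cE _ mG G0).
rewrite -(flat_intZ a1 (measurableT_comp mG (measurable_mulmx D)) (fun v => G0 (D *m v)%R)).
congr flat_int; apply/funext => v.
have mDv : measurable_fun setT (fun x : measurableTypeR R => f (cons_colvec (x, (D *m v)%R))).
  exact: (measurableT_comp mf (measurable_cons_colvecr _)).
rewrite -(flat_int1_affine ((b *m v)%R ord0 ord0) a0 mDv (fun x => f0 _)).
congr flat_int1; apply/funext => x; congr f.
by rewrite mul_block_cons scaler0 add0r.
Qed.

(** At a fixed first coordinate [x], this shear translates the other coordinates by [x *: c]. *)
Lemma flat_scaling_lower n (c : 'cV[R]_n) :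
  flat_scaling (block_mx 1%:M 0 c 1%:M : 'M[R]_(1 + n)).
Proof.
exists 1%R => // f mf f0; rewrite mul1e.
set N := block_mx _ _ _ _.
have mfN : measurable_fun setT (fun x => f (N *m x)%R).
  exact: (measurableT_comp mf (measurable_mulmx _)).
rewrite (flat_intS mf f0) (flat_intS mfN (fun x => f0 (N *m x)%R)).
congr flat_int1; apply/funext => x.
have mx : measurable_fun setT (fun v : 'cV[R]_n => f (cons_colvec (x : measurableTypeR R, v))).
  exact: (measurableT_comp mf (measurable_cons_colvecl _)).
rewrite -(flat_int_translate (x *: c) mx (fun v => f0 _)).
congr flat_int; apply/funext => v; congr f.
by rewrite mul_block_cons mul0mx mxE addr0 !mul1mx mul1r.
Qed.

Lemma flat_scaling1 n : flat_scaling (1%:M : 'M[R]_n).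
Proof.
exists 1%R => // f mf f0; rewrite mul1e.
by congr flat_int; apply/funext => x; rewrite mul1mx.
Qed.

(** Induction on the dimension. With a nonzero pivot, the matrix is a lower shear times an upper
    block matrix whose lower block is the Schur complement [D']; a zero pivot is first repaired by a
    row operation. *)
Lemma flat_scaling_unitmx n (M : 'M[R]_n) : M \in unitmx -> flat_scaling M.
Proof.
elim: n M => [|n ih] M uM; first by rewrite (flatmx0 M) -(flatmx0 1%:M); exact: flat_scaling1.
have pivot (N : 'M[R]_(1 + n)) : N \in unitmx -> (N ord0 ord0 != 0)%R -> flat_scaling N.
  set a0 := N ord0 ord0 => uN a0neq0.
  set a := ulsubmx N; set b := ursubmx N; set c := dlsubmx N; set D := drsubmx N.
  have aE : a = a0%:M.
    apply/matrixP => i j; rewrite !ord1 !mxE /= mulr1n.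
    by congr (N _ _); apply: val_inj.
  pose D' := (D - (a0^-1 *: c) *m b)%R.
  have NE : N = (block_mx 1%:M 0 (a0^-1 *: c) 1%:M *m block_mx a0%:M b 0 D')%R.
    rewrite -[N](@submxK _ 1 n 1 n) -/a -/b -/c -/D mulmx_block aE.
    rewrite !mul1mx !mul0mx !addr0 mul_mx_scalar scalerA divff// scale1r.
    by rewrite /D' addrC subrK.
  rewrite NE; apply: flat_scalingM; first exact: flat_scaling_lower.
  apply: flat_scaling_upper => //; apply: ih.
  move: uN; rewrite NE unitmx_mul => /andP[_].
  by rewrite !unitmxE det_ublock unitrM => /andP[].
have [M00|] := eqVneq (M ord0 ord0) 0%R; last exact: pivot.
(* Otherwise the first column vanishes and the first basis vector lies in the kernel of [M]. *)
have [i Mi] : exists i : 'I_n.+1, (M i ord0 != 0)%R.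
  apply/existsP; apply: contraT; rewrite negb_exists => /forallP M0.
  have /(congr1 (mulmx (invmx M))) : (M *m delta_mx ord0 (ord0 : 'I_1) = 0)%R.
    rewrite -colE; apply/matrixP => j k; rewrite !mxE; apply/eqP.
    by have := M0 j; rewrite negbK.
  rewrite mulKmx// mulmx0 => /matrixP/(_ ord0 ord0)/eqP.
  by rewrite !mxE !eqxx oner_eq0.
have : i != ord0 by apply: contraNneq Mi => ->; rewrite M00.
case: (@split_ordP 1 n i) Mi => k -> Mk; first by rewrite (ord1 k) => /eqP; case; apply/val_inj.
(* [E] adds row [k] of the lower block to the first row, so the pivot becomes the nonzero entry
   found above; [E'] undoes this. *)
move=> _; pose r : 'rV[R]_n := delta_mx ord0 k.
have shear_unit (q : 'rV[R]_n) : flat_scaling (block_mx 1%:M q 0 1%:M : 'M[R]_(1 + n)).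
  by apply: flat_scaling_upper; [exact: oner_neq0|exact: flat_scaling1].
pose E : 'M[R]_(1 + n) := block_mx 1%:M r 0 1%:M.
pose E' : 'M[R]_(1 + n) := block_mx 1%:M (- r) 0 1%:M.
have E'E : (E' *m E = 1%:M)%R.
  rewrite mulmx_block !mul1mx !mulmx1 !mul0mx !mulmx0 !addr0 add0r subrr.
  by rewrite -scalar_mx_block.
have -> : M = (E' *m (E *m M))%R by rewrite mulmxA E'E mul1mx.
apply: flat_scalingM; first exact: shear_unit.
apply: pivot.
  rewrite unitmx_mul uM andbT unitmxE det_ublock !det1 mulr1; exact: unitr1.
have o0 : ord0 = lshift n ord0 :> 'I_(1 + n) by exact: val_inj.
rewrite mxE big_split_ord/= big_ord1 -o0 M00 mulr0 add0r (bigD1 k)//= big1 ?addr0.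
  by rewrite {1}o0 block_mxEur mxE !eqxx mul1r.
by move=> j jk; rewrite {1}o0 block_mxEur mxE (negbTE jk) andbF mul0r.
Qed.

End linear_change_of_variables.

(** * Linear images of the standard Gaussian *)

Section linear_image.
Context (R : realType).
Local Open Scope ereal_scope.

Lemma measurable_col_mx p q d (T : measurableType d) (f : T -> 'cV[R]_p) (g : T -> 'cV[R]_q) :
  measurable_fun setT f -> measurable_fun setT g ->
  measurable_fun setT (fun t => col_mx (f t) (g t)).
Proof.
move=> mf mg; apply: measurable_fun_colvecP => i.
case: (split_ordP i) => j ->.
  under eq_fun do rewrite col_mxEu.
  exact: (measurableT_comp (measurable_colvec_coor j)).
under eq_fun do rewrite col_mxEd.
exact: (measurableT_comp (measurable_colvec_coor j)).
Qed.

Lemma cons_col_mx p q (x : R) (u : 'cV[R]_p) (v : 'cV[R]_q) :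
  cons_colvec (x : measurableTypeR R, col_mx u v) =
  col_mx (cons_colvec (x : measurableTypeR R, u)) v.
Proof.
rewrite /cons_colvec; have /= := @col_mxA _ 1 p q 1 (const_mx x) u v => ->.
exact: castmx_id.
Qed.

(** Independence of two blocks of coordinates. Since [std_gaussian] peels off one coordinate at a
    time, the induction is on the size of the upper block. *)
Lemma std_gaussian_col_mx p q (f : 'cV[R]_(p + q) -> \bar R) :
  measurable_fun setT f -> (forall x, 0 <= f x) ->
  \int[std_gaussian R (p + q)]_x f x =
  \int[std_gaussian R p]_u \int[std_gaussian R q]_v f (col_mx u v).
Proof.
elim: p f => [|p ih] f mf f0.
  transitivity (\int[std_gaussian R 0]_u \int[std_gaussian R q]_v f v).
    by rewrite integral_cst//= probability_setT mule1.
  apply: eq_integral => u _; apply: eq_integral => v _; congr f.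
  apply/matrixP => i j; rewrite mxE; case: splitP => [[]//|k /= ik].
  by congr (v _ _); apply: val_inj.
rewrite (ge0_integral_std_gaussianS mf f0).
rewrite (ge0_integral_std_gaussianS
  (f := fun u => \int[std_gaussian R q]_v f (col_mx u v))); last 2 first.
- apply: (@measurable_fun_fubini_tonelli_F _ _ _ _ _ (std_gaussian R q)
    (fun z => f (col_mx z.1 z.2))).
    by apply: (measurableT_comp mf); exact: measurable_col_mx.
  by move=> z; exact: f0.
- by move=> u; apply: integral_ge0 => v _; exact: f0.
apply: eq_integral => x _; rewrite ih.
- apply: eq_integral => u _; apply: eq_integral => v _.
  by rewrite cons_col_mx.
- exact: (measurableT_comp mf (measurable_cons_colvecl _)).
- by move=> u; exact: f0.
Qed.

(** The covariance of [W *m z] for a standard Gaussian [z]. *)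
Definition gram p q (W : 'M[R]_(p, q)) : 'M[R]_p := (W *m W^T)%R.

Definition qform p (Q : 'M[R]_p) (x : 'cV[R]_p) : R := (x^T *m Q *m x)%R ord0 ord0.

Lemma measurable_qform p (Q : 'M[R]_p) : measurable_fun setT (qform Q).
Proof. exact: measurable_bilin. Qed.

Lemma sqnorm_ge0 p (x : 'cV[R]_p) : (0 <= sqnorm x)%R.
Proof. by rewrite sqnormE; apply: sumr_ge0 => i _; exact: sqr_ge0. Qed.

Lemma sqnorm_eq0 p (x : 'cV[R]_p) : (sqnorm x == 0)%R = (x == 0)%R.
Proof.
apply/idP/eqP => [|->]; last by rewrite /sqnorm mulmx0 mxE.
rewrite sqnormE psumr_eq0 => [/allP x0|i _]; last exact: sqr_ge0.
apply/matrixP => i j; rewrite ord1 mxE; apply/eqP.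
by have := x0 i; rewrite mem_index_enum sqrf_eq0 => /(_ isT).
Qed.

Lemma qform_gram p q (W : 'M[R]_(p, q)) (x : 'cV[R]_p) :
  qform (gram W) x = sqnorm (W^T *m x)%R.
Proof. by rewrite /qform /sqnorm /gram trmx_mul trmxK !mulmxA. Qed.

Lemma gram_unitmx p q (W : 'M[R]_(p, q)) : row_free W -> gram W \in unitmx.
Proof.
move=> fW; rewrite -row_free_unit -kermx_eq0; apply/rowV0P => v /sub_kermxP vG.
have : qform (gram W) v^T = 0%R by rewrite /qform trmxK vG mul0mx mxE.
rewrite qform_gram => /eqP; rewrite sqnorm_eq0 -trmx_mul trmx_eq0 => /eqP vW.
by apply: (row_free_inj fW); rewrite mul0mx.
Qed.

(** The rows of [Z] form a basis of the orthogonal complement of the row space of [W], so stacking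
    [W] over [Z] gives a square matrix with block diagonal Gram matrix. *)
Lemma row_free_complement p q (W : 'M[R]_(p, q)) : row_free W ->
  exists s (Z : 'M[R]_(s, q)), [/\ q = (p + s)%N, row_free Z & (Z *m W^T = 0)%R].
Proof.
move=> fW; exists (\rank (kermx W^T)), (row_base (kermx W^T)); split.
- by rewrite mxrank_ker mxrank_tr (eqP fW) subnKC// -(eqP fW) rank_leq_col.
- exact: row_base_free.
- by apply/sub_kermxP; rewrite eq_row_base.
Qed.

Lemma gram_col_mx p s q (W : 'M[R]_(p, q)) (Z : 'M[R]_(s, q)) : (Z *m W^T = 0)%R ->
  gram (col_mx W Z) = block_mx (gram W) 0 0 (gram Z).
Proof.
move=> ZW; rewrite /gram tr_col_mx mul_col_row ZW.
by rewrite -[(W *m Z^T)%R]trmxK trmx_mul trmxK ZW trmx0.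
Qed.

Lemma invmx_diag_block p s (G : 'M[R]_p) (H : 'M[R]_s) : G \in unitmx -> H \in unitmx ->
  invmx (block_mx G 0 0 H) = block_mx (invmx G) 0 0 (invmx H).
Proof.
move=> uG uH.
have GH : (block_mx G 0 0 H *m block_mx (invmx G) 0 0 (invmx H) = 1%:M)%R.
  by rewrite mulmx_block !mulmx0 !mul0mx !addr0 !add0r !mulmxV// -scalar_mx_block.
have [u _] := mulmx1_unit GH.
by rewrite -[RHS](mulKmx u) GH mulmx1.
Qed.

Lemma qform_diag_block p s (G : 'M[R]_p) (H : 'M[R]_s) u v :
  qform (block_mx G 0 0 H) (col_mx u v) = (qform G u + qform H v)%R.
Proof.
rewrite /qform tr_col_mx mul_row_block !mulmx0 addr0 add0r mul_row_col.
by rewrite mxE.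
Qed.

(** Under [x = M *m z], the squared norm of [z] becomes the quadratic form of [invmx (gram M)] at
    [x]; the constant is the scaling factor of [M]. *)
Lemma ge0_integral_std_gaussian_unit n (M : 'M[R]_n) : M \in unitmx ->
  exists2 c : R, (0 < c)%R &
  forall f, measurable_fun setT f -> (forall x, 0 <= f x) ->
  \int[std_gaussian R n]_z f (M *m z)%R =
  \int[std_gaussian R n]_x (f x * (c * expR (sqnorm x / 2 - qform (invmx (gram M)) x / 2))%:E).
Proof.
move=> uM; have [c c0 cE] := flat_scaling_unitmx uM; exists c => // f mf f0.
(* The added exponential, evaluated at [M *m z], cancels the flat weight at [z]. *)
pose h (x : 'cV[R]_n) := f x * (expR (- (qform (invmx (gram M)) x / 2)))%:E.
have mh : measurable_fun setT h.
  apply: emeasurable_funM => //; apply/measurable_EFinP; apply: measurableT_comp => //.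
  apply: measurableT_comp => //; apply: measurable_funM => //; exact: measurable_qform.
have h0 x : 0 <= h x by rewrite mule_ge0// lee_fin expR_ge0.
transitivity (flat_int (fun z => h (M *m z)%R)).
  apply: eq_integral => z _; rewrite /h -muleA -EFinM -expRD.
  suff -> : qform (invmx (gram M)) (M *m z) = sqnorm z by rewrite addNr expR0 mule1.
  have /mulmx1C MK : (M *m (M^T *m invmx (gram M)) = 1%:M)%R.
    by rewrite mulmxA mulmxV// unitmx_mul unitmx_tr uM.
  by rewrite /qform /sqnorm trmx_mul -!mulmxA (mulmxA M^T) (mulmxA (M^T *m _)%R) MK mul1mx.
rewrite (cE h mh h0).
rewrite -(flat_intZ (ltW c0) mh h0); apply: eq_integral => x _.
rewrite /h /flat_weight -!muleA muleCA; congr (_ * _).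
by rewrite -!EFinM mulrA mulrAC -mulrA -expRD addrC mulrC.
Qed.

Lemma measurable_gauss_weight n (Q : 'M[R]_n) (c : R) :
  measurable_fun setT (fun x : 'cV[R]_n => (c * expR (sqnorm x / 2 - qform Q x / 2))%R).
Proof.
apply: measurable_funM => //; apply: measurableT_comp => //; apply: measurable_funB.
  by apply: measurable_funM => //; exact: measurable_sqnorm.
by apply: measurable_funM => //; exact: measurable_qform.
Qed.

(** Completing [W] by the orthogonal rows [Z] makes the density of [M *m z] a product; integrating
    out the [Z] block leaves a constant. *)
Lemma ge0_integral_std_gaussian_row_free p q (W : 'M[R]_(p, q)) : row_free W ->
  exists2 c : R, (0 < c)%R &
  forall f, measurable_fun setT f -> (forall x, 0 <= f x) ->
  \int[std_gaussian R q]_z f (W *m z)%R =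
  \int[std_gaussian R p]_x (f x * (c * expR (sqnorm x / 2 - qform (invmx (gram W)) x / 2))%:E).
Proof.
move=> fW; have [s [Z [qE fZ ZW]]] := row_free_complement fW.
subst q; pose M := col_mx W Z.
have gM : gram M = block_mx (gram W) 0 0 (gram Z) by exact: gram_col_mx.
have uM : M \in unitmx.
  have : gram M \in unitmx.
    by rewrite gM unitmxE det_ublock unitrM -!unitmxE !gram_unitmx.
  by rewrite unitmx_mul => /andP[].
have [c c0 cE] := ge0_integral_std_gaussian_unit uM.
pose e t (Q : 'M[R]_t) (x : 'cV[R]_t) := expR (sqnorm x / 2 - qform Q x / 2).
have me t Q : measurable_fun setT (@e t Q).
  by have := measurable_gauss_weight Q 1; under eq_fun do rewrite mul1r.
have e0 t Q x : (0 < @e t Q x)%R by exact: expR_gt0.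
have eM u v : e _ (invmx (gram M)) (col_mx u v) =
    (e _ (invmx (gram W)) u * e _ (invmx (gram Z)) v)%R.
  rewrite /e gM invmx_diag_block ?gram_unitmx// qform_diag_block sqnorm_col_mx.
  by rewrite -expRD; congr expR; lra.
pose I := \int[std_gaussian R s]_v (e _ (invmx (gram Z)) v)%:E.
have I0 : 0 <= I by apply: integral_ge0 => v _; rewrite lee_fin ltW.
have key f : measurable_fun setT f -> (forall x, 0 <= f x) ->
  \int[std_gaussian R (p + s)]_z f (W *m z)%R =
  \int[std_gaussian R p]_x (f x * (c%:E * I * (e _ (invmx (gram W)) x)%:E)).
  move=> mf f0.
  have mfu : measurable_fun setT (fun x : 'cV[R]_(p + s) => f (usubmx x)).
    apply: (measurableT_comp mf); apply: measurable_fun_colvecP => i.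
    under eq_fun do rewrite mxE.
    exact: measurable_colvec_coor.
  transitivity (\int[std_gaussian R (p + s)]_z f (usubmx (M *m z))%R).
    by apply: eq_integral => z _; rewrite mul_col_mx col_mxKu.
  have mce : measurable_fun setT (fun x => (c * e _ (invmx (gram M)) x)%:E).
    by apply/measurable_EFinP; exact: (measurable_funM (measurable_cst _) (me _ _)).
  rewrite (cE _ mfu (fun x => f0 _)) std_gaussian_col_mx; last 2 first.
  - exact: emeasurable_funM.
  - by move=> x; rewrite mule_ge0// lee_fin mulr_ge0 ?expR_ge0// ltW.
  apply: eq_integral => u _.
  transitivity (\int[std_gaussian R s]_v
     (f u * (c * e _ (invmx (gram W)) u)%:E * (e _ (invmx (gram Z)) v)%:E)).
    apply: eq_integral => v _; rewrite col_mxKu.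
    by rewrite -/(e _ (invmx (gram M)) (col_mx u v)) eM mulrA EFinM muleA.
  rewrite ge0_integralZl; last 4 first.
  - exact: measurableT.
  - by apply/measurable_EFinP; exact: me.
  - by move=> v _; rewrite lee_fin ltW.
  - by rewrite mule_ge0// lee_fin mulr_ge0 ?expR_ge0// ltW.
  by rewrite -/I -muleA EFinM; congr (_ * _); rewrite muleAC.
have cI0 : 0 <= c%:E * I by rewrite mule_ge0// lee_fin ltW.
(* The test function one: total mass forces [c%:E * I] to be positive and finite without computing
   [I]. *)
have cIK : 1 = c%:E * I * \int[std_gaussian R p]_x (e _ (invmx (gram W)) x)%:E.
  rewrite -ge0_integralZl; last 4 first.
  - exact: measurableT.
  - by apply/measurable_EFinP; exact: me.
  - by move=> v _; rewrite lee_fin ltW.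
  - exact: cI0.
  transitivity (\int[std_gaussian R (p + s)]_z cst 1 (W *m z)%R).
    by rewrite integral_cst// mul1e; apply/esym; exact: probability_setT.
  rewrite (key (cst 1))//.
  by apply: eq_integral => x _; rewrite mul1e.
have IW0 : 0 < \int[std_gaussian R p]_x (e _ (invmx (gram W)) x)%:E.
  rewrite lt0e; apply/andP; split; last by apply: integral_ge0 => v _; rewrite lee_fin ltW.
  by apply/eqP => IW; move: cIK => /eqP; rewrite IW mule0 onee_eq0.
have [r rE] : exists r, c%:E * I = r%:E.
  move: cI0 cIK; case: (c%:E * I) => [r _ _| _ |//]; first by exists r.
  by rewrite gt0_mulye.
have r0 : (0 < r)%R.
  rewrite lt0r -lee_fin -rE cI0 andbT; apply/eqP => r0.
  by move: cIK => /eqP; rewrite rE r0 mul0e onee_eq0.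
exists r => // f mf f0; rewrite key//.
by apply: eq_integral => x _; rewrite rE EFinM.
Qed.

(** Log-density, relative to the standard Gaussian, of the Gaussian with mean [a] and inverse
    covariance [Q]: the term [sqnorm x / 2] removes the exponent of the reference, and [k] stands
    for the log of the normalizing constant. *)
Definition gauss_logdens n (Q : 'M[R]_n) (k : R) (a x : 'cV[R]_n) : R :=
  (k + sqnorm x / 2 - qform Q (x - a) / 2)%R.

(** Translation invariance moves the mean into the density. One [k] serves every [a], which matters
    because the mean of the policy varies with the state. *)
Lemma ge0_integral_gaussian_image p q (W : 'M[R]_(p, q)) : row_free W ->
  exists k : R, forall a f, measurable_fun setT f -> (forall x, 0 <= f x) ->
  \int[std_gaussian R q]_z f (a + W *m z)%R =
  \int[std_gaussian R p]_x (f x * (expR (gauss_logdens (invmx (gram W)) k a x))%:E).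
Proof.
move=> /ge0_integral_std_gaussian_row_free[c c0 cE]; exists (ln c) => a f mf f0.
set Q := invmx (gram W).
pose g x := f x * (c * expR (- (qform Q (x - a) / 2)))%:E.
have mg : measurable_fun setT g.
  apply: emeasurable_funM => //; apply/measurable_EFinP; apply: measurable_funM => //.
  apply: measurableT_comp => //; apply: measurableT_comp => //; apply: measurable_funM => //.
  by apply: (measurableT_comp (measurable_qform Q)); exact: measurable_addcv.
have g0 x : 0 <= g x by rewrite mule_ge0// lee_fin mulr_ge0 ?expR_ge0// ltW.
have mfa : measurable_fun setT (fun x => f (a + x)%R).
  by apply: (measurableT_comp mf); exact: measurable_addcv.
rewrite (cE _ mfa (fun x => f0 _)).
transitivity (flat_int (fun x => g (a + x)%R)).
  apply: eq_integral => x _; rewrite /g -muleA; congr (_ * _).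
  by rewrite -EFinM -mulrA -expRD addrC addrAC subrr add0r addrC.
rewrite (flat_int_translate a mg g0); apply: eq_integral => x _.
rewrite /g -muleA; congr (_ * _); rewrite -EFinM -mulrA -expRD.
rewrite -[in LHS](lnK (c0 : c \is Num.pos)) -expRD.
by congr (expR _)%:E; rewrite /gauss_logdens; lra.
Qed.

End linear_image.

(** * Positive definite matrices and Cholesky factors *)

Section posdef.
Context (R : realType).

(** Ensures that the choice made in [cov_factor] does not fall back on its default value. The
    induction splits off the first row and column and factors the Schur complement. *)
Lemma posdef_cholesky n (S : 'M[R]_n) : posdef S -> exists L : 'M[R]_n, L *m L^T = S.
Proof.
elim: n S => [|n ih] S [symS posS]; first by exists 0; rewrite [LHS]flatmx0 [RHS]flatmx0.
pose S' : 'M[R]_(1 + n) := S.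
set a := ulsubmx S'; set b := dlsubmx S'; set D := drsubmx S'.
have SE : S' = block_mx a b^T b D.
  rewrite -[LHS](@submxK _ 1 n 1 n) -/a -/b -/D; congr block_mx.
  by rewrite /b trmx_dlsub [S'^T]symS.
have symD : D^T = D by rewrite /D trmx_drsub [S'^T]symS.
pose a0 := a ord0 ord0; have aE : a = a0%:M by rewrite [a]mx11_scalar.
have quadS (u : 'cV[R]_1) (v : 'cV[R]_n) :
    (col_mx u v)^T *m S' *m col_mx u v =
    u^T *m a *m u + v^T *m b *m u + (u^T *m b^T *m v + v^T *m D *m v).
  by rewrite SE tr_col_mx mul_row_block mul_row_col !mulmxDl.
have a0_gt0 : 0 < a0.
  have /posS : col_mx (1%:M : 'cV[R]_1) (0 : 'cV[R]_n) != 0.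
    apply/eqP => /(congr1 usubmx)/matrixP/(_ ord0 ord0).
    by rewrite col_mxKu !mxE /= => /eqP; rewrite oner_eq0.
  by rewrite quadS !trmx0 !mul0mx !mulmx0 !addr0 trmx1 mul1mx mulmx1.
pose s := Num.sqrt a0; have s_gt0 : 0 < s by rewrite sqrtr_gt0.
have ssa : s * s = a0 by rewrite -expr2 sqr_sqrtr// ltW.
pose c := s^-1 *: b.
have cT : c^T = s^-1 *: b^T by rewrite linearZ.
have [L' L'E] : exists L' : 'M[R]_n, L' *m L'^T = D - c *m c^T.
  apply: ih; split.
    by rewrite linearB/= trmx_mul trmxK symD.
  (* The form of the Schur complement at [y] is the form of [S] at [col_mx u y], where [u] minimizes
     the latter over the first coordinate. *)
  move=> y y0; pose p := (b^T *m y) ord0 ord0; pose u : 'cV[R]_1 := (- (p / a0))%:M.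
  have bty : b^T *m y = p%:M by rewrite [LHS]mx11_scalar.
  have ytb : y^T *m b = p%:M by rewrite -[LHS]trmxK trmx_mul trmxK bty tr_scalar_mx.
  have /posS : col_mx u y != 0.
    by apply: contra_neq y0 => /(congr1 dsubmx); rewrite col_mxKd linear0.
  rewrite quadS aE /u tr_scalar_mx ytb -[X in X + _ *m D *m _]mulmxA bty -!scalar_mxM.
  rewrite mulmxBr mulmxBl cT /c -!(scalemxAl, scalemxAr) mulmxA ytb.
  rewrite -[p%:M *m b^T *m y]mulmxA bty -scalar_mxM.
  move: (y^T *m D *m y) => q; rewrite !mxE !mulr1n => qpos.
  suff -> : q ord0 ord0 - s^-1 * (s^-1 * (p * p)) =
     - (p / a0) * a0 * - (p / a0) + p * - (p / a0) + (- (p / a0) * p + q ord0 ord0) by [].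
  rewrite mulrA -invfM ssa; field; exact: lt0r_neq0.
exists (block_mx s%:M 0 c L' : 'M[R]_(1 + n)).
rewrite (@tr_block_mx _ 1 n 1 n) (@mulmx_block _ 1 n 1 n 1 n) !trmx0 !mulmx0 !mul0mx !addr0.
rewrite tr_scalar_mx -scalar_mxM ssa L'E addrC subrK -/S' SE aE.
apply: (f_equal4 (@block_mx R 1 n 1 n)) => //.
- by rewrite cT mul_scalar_mx scalerA divff ?scale1r// gt_eqF.
- by rewrite mul_mx_scalar /c scalerA divff ?scale1r// gt_eqF.
Qed.

Lemma posdef_unitmx n (S : 'M[R]_n) : posdef S -> S \in unitmx.
Proof.
move=> [symS posS]; rewrite -row_free_unit -kermx_eq0; apply/rowV0P => v /sub_kermxP vS.
apply/eqP; apply: contraT => v0; have := posS v^T; rewrite trmx_eq0 => /(_ v0).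
by rewrite trmxK vS mul0mx mxE ltxx.
Qed.

Lemma gram_cov_factor n (S : 'M[R]_n) : posdef S -> gram (cov_factor S) = S.
Proof.
by move=> /posdef_cholesky[L LS]; rewrite /cov_factor /gram; case: xgetP => [L' -> //|/(_ L)].
Qed.

Lemma row_free_gram p q (W : 'M[R]_(p, q)) : posdef (gram W) -> row_free W.
Proof.
move=> /posdef_unitmx; rewrite -row_free_unit /row_free => /eqP GW.
by rewrite eqn_leq rank_leq_row -[X in (X <= _)%N]GW mxrankM_maxl.
Qed.

Lemma row_free_cov_factor n (S : 'M[R]_n) : posdef S -> row_free (cov_factor S).
Proof. by move=> pS; apply: row_free_gram; rewrite gram_cov_factor. Qed.

Lemma gram_row_mx p q r (W : 'M[R]_(p, q)) (Z : 'M[R]_(p, r)) :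
  gram (row_mx W Z) = gram W + gram Z.
Proof. by rewrite /gram tr_row_mx mul_row_col. Qed.

Lemma gramM p q r (W : 'M[R]_(p, q)) (Z : 'M[R]_(q, r)) :
  gram (W *m Z) = W *m gram Z *m W^T.
Proof. by rewrite /gram trmx_mul !mulmxA. Qed.

Lemma posdefD_gram p q (S : 'M[R]_p) (W : 'M[R]_(p, q)) : posdef S -> posdef (S + gram W).
Proof.
move=> [symS posS]; split; first by rewrite linearD/= symS /gram trmx_mul trmxK.
move=> x x0; rewrite mulmxDr mulmxDl mxE ltr_pwDl ?posS//.
by have := sqnorm_ge0 (W^T *m x); rewrite -qform_gram.
Qed.

End posdef.

(** * Square integrability and laws *)

Section square_integrable.
Context d (T : measurableType d) (R : realType) (P : probability T R).
Local Open Scope ereal_scope.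

Lemma Lfun2P (f : T -> R) : measurable_fun setT f ->
  \int[P]_x (f x ^+ 2)%:E < +oo -> f \in Lfun P 2%:E.
Proof.
move=> mf f2; rewrite inE; apply/andP; split; first by rewrite inE.
rewrite !inE/= /finite_norm unlock /Lnorm poweR_lty//.
by under eq_integral => x _ do rewrite /= powR_mulrn// real_normK ?num_real//.
Qed.

Lemma Lfun2_cst (c : R) : (fun=> c) \in Lfun P 2%:E.
Proof. exact: (Lfun_cst P c 2). Qed.

Lemma Lfun2D (f g : T -> R) : f \in Lfun P 2%:E -> g \in Lfun P 2%:E ->
  (fun x => f x + g x)%R \in Lfun P 2%:E.
Proof.
have p1 : (1 : \bar R) <= 2%:E by rewrite lee1n.
exact: ((Lfun_addr_closed P p1).2 f g).
Qed.

Lemma Lfun2Z (c : R) (f : T -> R) : f \in Lfun P 2%:E -> (fun x => c * f x)%R \in Lfun P 2%:E.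
Proof.
move=> lf; have := @Lfun_scale _ _ _ P f c 2%R (ltac:(by rewrite ler1n)) lf.
by rewrite (_ : (c \o* f)%R = (fun x => c * f x)%R)//; apply/funext => x; rewrite /= mulrC.
Qed.

Lemma Lfun2_sum (I : Type) (s : seq I) (f : I -> T -> R) :
  (forall i, f i \in Lfun P 2%:E) -> (fun x => \sum_(i <- s) f i x)%R \in Lfun P 2%:E.
Proof.
move=> lf; elim: s => [|i s ih].
  by under eq_fun do rewrite big_nil; exact: Lfun2_cst.
by under eq_fun do rewrite big_cons; exact: Lfun2D.
Qed.

Definition Lfun2_colvec n (X : T -> 'cV[R]_n) :=
  forall i, (fun t => X t i ord0) \in Lfun P 2%:E.

Lemma Lfun2_colvecD n (X Y : T -> 'cV[R]_n) :
  Lfun2_colvec X -> Lfun2_colvec Y -> Lfun2_colvec (fun t => X t + Y t)%R.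
Proof. by move=> lX lY i; under eq_fun do rewrite mxE; exact: Lfun2D. Qed.

Lemma Lfun2_colvec_cst n (a : 'cV[R]_n) : Lfun2_colvec (fun=> a).
Proof. by move=> i; exact: Lfun2_cst. Qed.

Lemma Lfun2_colvec_mulmx n p (M : 'M[R]_(p, n)) (X : T -> 'cV[R]_n) :
  Lfun2_colvec X -> Lfun2_colvec (fun t => M *m X t)%R.
Proof.
move=> lX i; under eq_fun do rewrite mxE.
by apply: Lfun2_sum => j; exact: Lfun2Z.
Qed.

Lemma Lfun2_colvecB n (X Y : T -> 'cV[R]_n) :
  Lfun2_colvec X -> Lfun2_colvec Y -> Lfun2_colvec (fun t => X t - Y t)%R.
Proof.
move=> lX lY; apply: Lfun2_colvecD => //.
have := Lfun2_colvec_mulmx (- 1%:M)%R lY.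
by under eq_fun do rewrite mulNmx mul1mx.
Qed.

(** Expanded in coordinates, this is a finite sum of products of two square integrable functions. *)
Lemma integrable_bilin p q (M : 'M[R]_(p, q)) (X : T -> 'cV[R]_p) (Y : T -> 'cV[R]_q) :
  Lfun2_colvec X -> Lfun2_colvec Y ->
  P.-integrable setT (fun t => (((X t)^T *m M *m Y t)%R ord0 ord0)%:E).
Proof.
move=> lX lY.
have -> : (fun t => (((X t)^T *m M *m Y t)%R ord0 ord0)%:E) =
    (fun t => \sum_(i <- enum 'I_p) (X t i ord0 * (M *m Y t)%R i ord0)%:E).
  apply/funext => t; rewrite sumEFin big_enum/= -mulmxA mxE.
  by congr EFin; apply: eq_bigr => i _; rewrite !mxE.
apply: integrable_sum => // i _.
by apply/Lfun1_integrable; apply: Lfun2_mul_Lfun1 => //; exact: Lfun2_colvec_mulmx.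
Qed.

Lemma integrable_sqnorm p (X : T -> 'cV[R]_p) :
  Lfun2_colvec X -> P.-integrable setT (fun t => (sqnorm (X t))%:E).
Proof.
move=> lX; have := integrable_bilin 1%:M lX lX.
by under eq_fun do rewrite mulmx1.
Qed.

Lemma integrable_gauss_logdens p (Q : 'M[R]_p) (k : R) (X Y : T -> 'cV[R]_p) :
  Lfun2_colvec X -> Lfun2_colvec Y ->
  P.-integrable setT (fun t => (gauss_logdens Q k (X t) (Y t))%:E).
Proof.
move=> lX lY.
have -> : (fun t => (gauss_logdens Q k (X t) (Y t))%:E) =
  (fun t => (k%:E + (2^-1)%:E * (sqnorm (Y t))%:E) - (2^-1)%:E * (qform Q (Y t - X t))%:E).
  apply/funext => t; rewrite /gauss_logdens EFinB EFinD.
  by rewrite (mulrC (sqnorm _)) (mulrC (qform _ _)) !EFinM.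
have iq : P.-integrable setT (fun t => (qform Q (Y t - X t))%:E).
  by apply: integrable_bilin; exact: Lfun2_colvecB.
apply: integrableB => //; last exact: integrableZl.
apply: integrableD => //; first exact: finite_measure_integrable_cst.
by apply: integrableZl => //; exact: integrable_sqnorm.
Qed.

End square_integrable.

(** * Second moments of Gaussian vectors *)

Section gaussian_moments.
Context (R : realType).
Local Open Scope ereal_scope.

(** Domination by a multiple of the density of variance two. With [t = x^2 / 4], the integrand is
    [4 t exp(-t) exp(-t)] up to the peak value, [t exp(-t) <= 1], and the other [exp(-t)] is the
    exponential of that density; [c] collects the 4 and the quotient of the two peaks. *)
Lemma normal_sqr_integral_lty : \int[normal_prob 0 1]_x (x ^+ 2)%:E < +oo :> \bar R.
Proof.
have s0 : (Num.sqrt 2 != 0 :> R)%R by rewrite sqrtr_eq0 -ltNge.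
pose c : R := (4 * normal_peak 1 / normal_peak (Num.sqrt 2))%R.
rewrite (ge0_integral_density (mu := @lebesgue_measure R) (nu := normal_prob 0 1)
  (h := normal_pdf 0 1)); last 5 first.
- exact: measurable_normal_pdf.
- by move=> x; exact: normal_pdf_ge0.
- by [].
- by apply/measurable_EFinP; exact: measurable_funX.
- by move=> x; rewrite lee_fin sqr_ge0.
apply: (@le_lt_trans _ _ 
  (\int[lebesgue_measure]_x (c * normal_pdf 0 (Num.sqrt 2) x)%:E)); last first.
  under eq_integral do rewrite EFinM.
  by rewrite integralZl// ?integral_normal_pdf ?mule1 ?ltry//; exact: integrable_normal_pdf.
apply: ge0_le_integral => //.
- by move=> x _; rewrite mule_ge0// lee_fin ?sqr_ge0 ?normal_pdf_ge0.
- apply: emeasurable_funM.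
    by apply/measurable_EFinP; exact: measurable_funX.
  by apply/measurable_EFinP; exact: measurable_normal_pdf.
- apply/measurable_EFinP; apply: measurable_funM => //; exact: measurable_normal_pdf.
move=> x _; rewrite -EFinM lee_fin !normal_pdfE ?oner_eq0//.
rewrite /c /normal_fun !subr0 expr1n sqr_sqrtr//.
have p0 := normal_peak_gt0 s0.
pose t : R := (x ^+ 2 / 4)%R.
have -> : (- x ^+ 2 / (1 *+ 2) = - t + - t)%R by rewrite /t mulr2n; field.
have -> : (- x ^+ 2 / (2 *+ 2) = - t)%R by rewrite /t mulr2n; field.
have -> : (x ^+ 2 = 4 * t)%R by rewrite /t; field.
rewrite expRD; set e := expR (- t); set p1 := normal_peak 1; set p2 := normal_peak _ in p0 *.
have p1_ge0 : (0 <= p1)%R by exact: normal_peak_ge0.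
have te : (t * e <= 1)%R.
  rewrite /e expRN ler_pdivrMr ?expR_gt0// mul1r.
  by apply: le_trans (expR_ge1Dx t); rewrite lerDr.
have -> : (4 * p1 / p2 * (p2 * e) = 4 * p1 * e)%R by field; rewrite gt_eqF.
have -> : (4 * t * (p1 * (e * e)) = 4 * p1 * e * (t * e))%R by ring.
by rewrite ler_piMr// !mulr_ge0// expR_ge0.
Qed.

Lemma Lfun2_std_gaussian n : Lfun2_colvec (std_gaussian R n) id.
Proof.
move=> i; have mi : measurable_fun setT (fun z : 'cV[R]_n => z i ord0).
  exact: measurable_colvec_coor.
apply: Lfun2P => //; elim: n i mi => [[]//|n ih] i mi.
have mi2 : measurable_fun setT (fun x : 'cV[R]_n.+1 => (x i ord0 ^+ 2)%:E).
  by apply/measurable_EFinP; exact: measurable_funX.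
have sq0 (x : 'cV[R]_n.+1) : 0 <= (x i ord0 ^+ 2)%:E by rewrite lee_fin sqr_ge0.
rewrite (ge0_integral_std_gaussianS mi2 sq0).
case: (@split_ordP 1 n i) => j ->{i mi mi2 sq0}.
  apply: le_lt_trans normal_sqr_integral_lty; rewrite le_eqVlt; apply/orP; left; apply/eqP.
  apply: eq_integral => x _.
  transitivity (\int[std_gaussian R n]_v (cst (x ^+ 2)%:E v)).
    by apply: eq_integral => v _; rewrite [cons_colvec _ _ _]col_mxEu mxE.
  by rewrite integral_cst//= probability_setT mule1.
have mj : measurable_fun setT (fun z : 'cV[R]_n => z j ord0).
  exact: measurable_colvec_coor.
apply: le_lt_trans (ih j mj); rewrite le_eqVlt; apply/orP; left; apply/eqP.
transitivity (\int[normal_prob 0 1]_x cst (\int[std_gaussian R n]_v (v j ord0 ^+ 2)%:E) x).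
  apply: eq_integral => x _; apply: eq_integral => v _.
  by rewrite [cons_colvec _ _ _]col_mxEd.
by rewrite integral_cst//= probability_setT mule1.
Qed.

Lemma Lfun2_linear_image n p (W : 'M[R]_(p, n)) : Lfun2_colvec (std_gaussian R n) (mulmx W).
Proof. by apply: Lfun2_colvec_mulmx; exact: Lfun2_std_gaussian. Qed.

End gaussian_moments.

Section same_law.
Context d d' d'' (T : measurableType d) (T' : measurableType d')
  (U : measurableType d'') (R : realType).
Variables (P : probability T R) (Q : probability T' R).
Local Open Scope ereal_scope.

(** Equality in law in the form in which Tonelli computations deliver it; the two variables may live
    on different probability spaces. *)
Definition same_law (X : T -> U) (Y : T' -> U) := forall f, measurable_fun setT f ->
  (forall u, 0 <= f u) -> \int[P]_t f (X t) = \int[Q]_t f (Y t).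

Lemma integral_same_law (X : T -> U) (Y : T' -> U) f : same_law X Y ->
  measurable_fun setT f -> \int[P]_t f (X t) = \int[Q]_t f (Y t).
Proof.
move=> XY mf; rewrite integralE [RHS]integralE; congr (_ - _).
  transitivity (\int[P]_t f^\+ (X t)).
    by apply: eq_integral => t _; rewrite !funeposE.
  rewrite XY//; last exact: measurable_funepos.
  by apply: eq_integral => t _; rewrite !funeposE.
transitivity (\int[P]_t f^\- (X t)).
  by apply: eq_integral => t _; rewrite !funenegE.
rewrite XY//; last exact: measurable_funeneg.
by apply: eq_integral => t _; rewrite !funenegE.
Qed.

End same_law.

Lemma Lfun2_same_law d d' (T : measurableType d) (T' : measurableType d') (R : realType)
    (P : probability T R) (Q : probability T' R) n (X : T -> 'cV[R]_n) (Y : T' -> 'cV[R]_n) :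
  same_law P Q X Y -> measurable_fun setT X -> Lfun2_colvec Q Y -> Lfun2_colvec P X.
Proof.
move=> XY mX lY i; apply: Lfun2P.
  exact: (measurableT_comp (measurable_colvec_coor i)).
rewrite (XY (fun x => (x i ord0 ^+ 2)%:E)).
- by have /integrableP[_] := Lfun2_integrable_sqr (lY i);
    under eq_integral do rewrite /= ger0_norm ?sqr_ge0//.
- by apply/measurable_EFinP; apply: measurable_funX; exact: measurable_colvec_coor.
- by move=> x; rewrite lee_fin sqr_ge0.
Qed.

(** * Relative entropy *)

Section divergence.
Context d (T : measurableType d) (R : realType).
Local Open Scope ereal_scope.

Lemma measurable_lne_fin (f : T -> \bar R) : (forall x, f x \is a fin_num) ->
  measurable_fun setT f -> measurable_fun setT (fun x => lne (f x)).
Proof.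
move=> ffin mf.
have -> : (fun x => lne (f x)) =
    (fun x => if (fine (f x) <= 0)%R then -oo else (ln (fine (f x)))%:E).
  by apply/funext => x; rewrite -{1}(fineK (ffin x)).
have mff : measurable_fun setT (fine \o f) by exact: measurableT_comp.
apply: measurable_fun_ifT => //; last by apply/measurable_EFinP; exact: measurableT_comp.
exact: measurable_fun_ler.
Qed.

Variables (P Q : probability T R) (l : T -> R).
Hypothesis ml : measurable_fun setT l.
Hypothesis PQ : forall f, measurable_fun setT f -> (forall x, 0 <= f x) ->
  \int[P]_x f x = \int[Q]_x (f x * (expR (l x))%:E).

(** The Radon-Nikodym derivative equals [expR (l x)] only [Q]-almost everywhere. Domination of [P]
    by [Q] carries the equality over to [P]-almost every point, which suffices for the integral of
    the logarithm. *)
Lemma KL_density : KL P Q = \int[P]_x (l x)%:E.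
Proof.
have mel : measurable_fun setT (fun x => (expR (l x))%:E).
  by apply/measurable_EFinP; exact: measurableT_comp.
have PE A : measurable A -> P A = \int[Q]_(x in A) (expR (l x))%:E.
  move=> mA; have := PQ (f := fun x => (\1_A x)%:E).
  rewrite integral_indic// setIT => ->.
  - rewrite [RHS]integral_mkcond; apply: eq_integral => x _.
    by rewrite patchE indicE; case: ifPn; rewrite ?mul1e// mul0e.
  - by apply/measurable_EFinP; exact: measurable_indic.
  - by move=> x; rewrite lee_fin.
have PltQ : P `<< Q.
  apply/null_content_dominatesP => A mA QA; rewrite PE//.
  by apply: null_set_integral => //; exact: measurable_funTS.
rewrite /KL; case: asboolP => // _.
set f := Radon_Nikodym _ _.
have PQf : charge_of_finite_measure P `<< Q by [].
have ffin x : f x \is a fin_num by exact: Radon_Nikodym_fin_num.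
have intf : Q.-integrable setT f by exact: Radon_Nikodym_integrable.
have aeQ : ae_eq Q setT f (fun x => (expR (l x))%:E).
  apply: integral_ae_eq => // E _ mE.
  by rewrite -PE// -Radon_Nikodym_integral.
have aeP := null_dominates_ae_eq measurableT PltQ aeQ.
apply: ae_eq_integral => //.
- by apply: measurable_lne_fin => //; exact: measurable_int intf.
- exact/measurable_EFinP.
- case: aeP => N [mN N0 sub]; exists N; split => // x /= H; apply: sub => /= fe; apply: H => Tx.
  by rewrite (fe Tx) lne_EFin ?expR_gt0// expRK.
Qed.

End divergence.

(** * Gibbs' inequality and its equality case *)

Section gibbs.
Context d (T : measurableType d) (R : realType) (mu : probability T R) (h : T -> R).
Local Open Scope ereal_scope.
Hypothesis ih : mu.-integrable setT (EFin \o h).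
Hypothesis h1 : \int[mu]_x (expR (- h x))%:E = 1.

Let mh : measurable_fun setT h.
Proof. by apply/measurable_EFinP; exact: measurable_int ih. Qed.

Let meh : measurable_fun setT (fun x => expR (- h x)).
Proof. by apply: measurableT_comp => //; exact: measurableT_comp. Qed.

(** Makes Gibbs' inequality pointwise: [expR (- h x) - 1] integrates to zero, so [g] and [h] have
    the same integral, while [g] is nonnegative and vanishes exactly where [h] does. *)
Let g x : R := (expR (- h x) - 1 + h x)%R.

Let mg : measurable_fun setT (EFin \o g).
Proof. by apply/measurable_EFinP; apply: measurable_funD => //; exact: measurable_funB. Qed.

Let g0 x : (0 <= g x)%R.
Proof. by have := expR_ge1Dx (- h x)%R; rewrite /g; lra. Qed.

Let gE : \int[mu]_x (g x)%:E = \int[mu]_x (h x)%:E.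
Proof.
have ie : mu.-integrable setT (fun x => (expR (- h x))%:E).
  apply/integrableP; split; first exact/measurable_EFinP.
  by under eq_integral do rewrite gee0_abs ?lee_fin ?expR_ge0//; rewrite h1 ltry.
have i1 : mu.-integrable setT (cst 1) by exact: finite_measure_integrable_cst.
transitivity (\int[mu]_x (((expR (- h x))%:E - cst 1 x) + (EFin \o h) x)); first by [].
rewrite integralD//; last exact: integrableB.
by rewrite integralB// h1 integral_cst//= probability_setT mule1 subee// add0e.
Qed.

Lemma gibbs_ge0 : 0 <= \int[mu]_x (h x)%:E.
Proof. by rewrite -gE; apply: integral_ge0 => x _; rewrite lee_fin. Qed.

(** A nonnegative [g] of zero integral vanishes almost everywhere, hence so does [h], and the
    density [expR (- h x)] is almost everywhere one. *)
Lemma gibbs_eq0 : \int[mu]_x (h x)%:E = 0 ->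
  forall f, measurable_fun setT f -> (forall x, 0 <= f x) ->
  \int[mu]_x (f x * (expR (- h x))%:E) = \int[mu]_x f x.
Proof.
move=> ih0 f mf f0.
have /ae_eq_integral_abs : \int[mu]_x `|(EFin \o g) x| = 0.
  by under eq_integral do rewrite gee0_abs ?lee_fin//; rewrite gE.
move=> /(_ measurableT mg) aeg.
apply: ge0_ae_eq_integral => //.
- by apply: emeasurable_funM => //; exact/measurable_EFinP.
- by move=> x _; rewrite mule_ge0// lee_fin expR_ge0.
case: aeg => N [mN N0 sub]; exists N; split => // x /= H; apply: sub => /= gx; apply: H => Tx.
have [gx0] : (g x)%:E = 0 := gx Tx.
suff -> : h x = 0%R by rewrite oppr0 expR0 mule1.
apply/eqP; apply: contraT => hx0; have := @expR_gt1Dx _ (- h x)%R.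
by rewrite oppr_eq0 => /(_ hx0); move: gx0; rewrite /g; lra.
Qed.

End gibbs.

(** * Path laws *)

Section path_law_integral.
Context (R : realType) (n m : nat).
Variables (A : nat -> 'M[R]_n) (B : nat -> 'M[R]_(n, m)).
Local Open Scope ereal_scope.
Implicit Types (init : probability 'cV[R]_n R) (K : policy R n m).

Lemma ge0_integral_path_law0 init K (F : 1.-tuple 'cV[R]_n -> \bar R) :
  measurable_fun setT F -> (forall xs, 0 <= F xs) ->
  \int[path_law A B init K 0]_xs F xs = \int[init]_x F [tuple x].
Proof. by move=> mF F0; rewrite [LHS]ge0_integral_distribution. Qed.

Lemma ge0_integral_path_lawS init K T (F : T.+2.-tuple 'cV[R]_n -> \bar R) :
  measurable_fun setT F -> (forall xs, 0 <= F xs) ->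
  \int[path_law A B init K T.+1]_xs F xs =
  \int[path_law A B init K T]_xs
    \int[K T (last_state xs)]_u F (extend_path (A T) (B T) (xs, u)).
Proof.
move=> mF F0; rewrite [LHS]ge0_integral_distribution//.
apply: (ge0_integral_semidirect _ (kprecomp (@last_state R n T) (K T))).
  exact: measurableT_comp.
by move=> z; exact: F0.
Qed.

Lemma measurable_integral_extend K T (F : T.+2.-tuple 'cV[R]_n -> \bar R) :
  measurable_fun setT F -> (forall xs, 0 <= F xs) ->
  measurable_fun setT (fun xs =>
    \int[K T (last_state xs)]_u F (extend_path (A T) (B T) (xs, u))).
Proof.
move=> mF F0.
apply: (@measurable_integral_pker _ _ _ _ _ (kprecomp (@last_state R n T) (K T))
  (fun z => F (extend_path (A T) (B T) z))).
  exact: measurableT_comp.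
by move=> z; exact: F0.
Qed.

Lemma measurable_nth_tuple T k : measurable_fun setT (fun xs : T.-tuple 'cV[R]_n => nth 0%R xs k).
Proof.
have [kT|Tk] := ltnP k T.
  rewrite (_ : (fun _ => _) = (fun xs => tnth xs (Ordinal kT))); first exact: measurable_tnth.
  by apply/funext => xs; rewrite (tnth_nth 0%R).
rewrite (_ : (fun _ => _) = cst 0%R)//; apply/funext => xs.
by rewrite nth_default// size_tuple.
Qed.

Lemma measurable_increment T k : measurable_fun setT
  (fun xs : T.-tuple 'cV[R]_n => nth 0 xs k.+1 - A k *m nth 0 xs k)%R.
Proof.
apply: measurable_addcv; first exact: measurable_nth_tuple.
under eq_fun do rewrite -mulNmx.
exact: (measurableT_comp (measurable_mulmx _) (@measurable_nth_tuple T k)).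
Qed.

Lemma last_stateE T (xs : T.+1.-tuple 'cV[R]_n) : last_state xs = nth 0%R xs T.
Proof. by rewrite /last_state (tnth_nth 0%R). Qed.

Lemma nth_extend_path (C : 'M[R]_n) p (D : 'M[R]_(n, p)) T (xs : T.+1.-tuple 'cV[R]_n) u k :
  nth 0%R (extend_path C D (xs, u)) k =
  if (k < T.+1)%N then nth 0%R xs k else
  if k == T.+1 then (C *m last_state xs + D *m u)%R else 0%R.
Proof. by rewrite /= nth_rcons size_tuple. Qed.

(* Log-likelihood ratio of two path laws whose one-step laws have log-ratio [g k x y]
   for the increment [y = B_k u] out of the state [x]. *)
Definition path_loglik (a : 'cV[R]_n -> R) (g : nat -> 'cV[R]_n -> 'cV[R]_n -> R) T
    (xs : T.+1.-tuple 'cV[R]_n) : R :=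
  (a (nth 0 xs 0) + \sum_(0 <= k < T) g k (nth 0 xs k) (nth 0 xs k.+1 - A k *m nth 0 xs k))%R.

Lemma measurable_path_loglik a g T : measurable_fun setT a ->
  (forall k, (k < T)%N -> measurable_fun setT (fun z => g k z.1 z.2)) ->
  measurable_fun setT (@path_loglik a g T).
Proof.
move=> ma mg; apply: measurable_funD.
  exact: (measurableT_comp ma (@measurable_nth_tuple T.+1 0)).
under eq_fun do rewrite big_mkord.
apply: measurable_sum => k.
have mxy : measurable_fun setT (fun xs : T.+1.-tuple 'cV[R]_n =>
    (nth 0%R xs k, nth 0%R xs k.+1 - A k *m nth 0%R xs k)%R).
  apply: measurable_fun_pair; first exact: measurable_nth_tuple.
  exact: measurable_increment.
exact: (measurableT_comp (mg k (ltn_ord k)) mxy).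
Qed.

Lemma path_loglikS a g T (xs : T.+1.-tuple 'cV[R]_n) u :
  path_loglik a g (extend_path (A T) (B T) (xs, u)) =
  (path_loglik a g xs + g T (last_state xs) (B T *m u))%R.
Proof.
rewrite /path_loglik big_nat_recr//= addrA; congr (_ + _ + _)%R.
- by rewrite -/(nth 0%R (extend_path (A T) (B T) (xs, u)) 0) nth_extend_path.
- rewrite big_nat [RHS]big_nat; apply: eq_bigr => k /andP[_ kT].
  have := nth_extend_path (A T) (B T) xs u; rewrite /= => nE.
  by rewrite !nE !ltnS (ltnW kT) kT.
- have := nth_extend_path (A T) (B T) xs u; rewrite /= => nE.
  rewrite !nE ltnS leqnn ltnn eqxx last_stateE addrC addKr//.
Qed.

(** Induction on the horizon, each stage adding one term to the log-ratio. The one-step hypothesis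
    tests functions of [B k *m u] only, since the input enters the path through this product. *)
Lemma path_law_density init init' K K' a g T :
  measurable_fun setT a ->
  (forall k, (k < T)%N -> measurable_fun setT (fun z => g k z.1 z.2)) ->
  (forall f, measurable_fun setT f -> (forall x, 0 <= f x) ->
    \int[init]_x f x = \int[init']_x (f x * (expR (a x))%:E)) ->
  (forall k x f, (k < T)%N -> measurable_fun setT f -> (forall y, 0 <= f y) ->
    \int[K k x]_u f (B k *m u)%R =
    \int[K' k x]_u (f (B k *m u)%R * (expR (g k x (B k *m u)))%:E)) ->
  forall F, measurable_fun setT F -> (forall xs, 0 <= F xs) ->
  \int[path_law A B init K T]_xs F xs =
  \int[path_law A B init' K' T]_xs (F xs * (expR (path_loglik a g xs))%:E).
Proof.
move=> ma + initE; elim: T => [|T ih] mg stepE F mF F0.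
  rewrite (ge0_integral_path_law0 _ _ mF F0) initE; last 2 first.
  - apply: (measurableT_comp mF); exact: measurable_initial_path.
  - by move=> x; exact: F0.
  rewrite ge0_integral_path_law0.
  - by apply: eq_integral => x _; rewrite /path_loglik big_geq// addr0.
  - apply: emeasurable_funM => //; apply/measurable_EFinP; apply: measurableT_comp => //.
    exact: measurable_path_loglik.
  - by move=> xs; rewrite mule_ge0// lee_fin expR_ge0.
have mel : measurable_fun setT (fun xs => (expR (@path_loglik a g T.+1 xs))%:E).
  apply/measurable_EFinP; apply: measurableT_comp => //.
  exact: measurable_path_loglik.
have mFe : measurable_fun setT (fun xs => F xs * (expR (@path_loglik a g T.+1 xs))%:E).
  exact: emeasurable_funM.
have Fe0 xs : 0 <= F xs * (expR (@path_loglik a g T.+1 xs))%:E.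
  by rewrite mule_ge0// lee_fin expR_ge0.
rewrite (ge0_integral_path_lawS _ _ mF F0) (ge0_integral_path_lawS _ _ mFe Fe0).
rewrite ih; last 4 first.
- by move=> k kT; apply: mg; rewrite ltnS ltnW.
- by move=> k x f kT; apply: stepE; rewrite ltnS ltnW.
- exact: measurable_integral_extend.
- by move=> xs; apply: integral_ge0 => u _; exact: F0.
apply: eq_integral => xs _.
have mFy : measurable_fun setT (fun y => F (extend_path (A T) (1%:M : 'M[R]_n) (xs, y))).
  apply: (measurableT_comp mF).
  exact: (measurableT_comp (measurable_extend_path (A T) 1%:M (k:=T)) (measurable_pair1 _)).
(* Feeding [B T *m u] through the identity input matrix gives the same path; this exhibits the
   integrand as a function of [B T *m u], as [stepE] requires. *)
have FE u : F (extend_path (A T) (B T) (xs, u)) =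
    F (extend_path (A T) (1%:M : 'M[R]_n) (xs, (B T *m u)%R)).
  by congr F; apply: val_inj; rewrite /= mul1mx.
under eq_integral do rewrite FE.
rewrite (stepE T _ _ (ltnSn T) mFy (fun y => F0 _)) -ge0_integralZr.
- by apply: eq_integral => u _; rewrite FE path_loglikS -muleA -EFinM -expRD addrC.
- exact: measurableT.
- apply: emeasurable_funM; first exact: (measurableT_comp mFy (measurable_mulmx _)).
  apply/measurable_EFinP; apply: measurableT_comp => //.
  have mxu : measurable_fun setT (fun u : 'cV[R]_m => (last_state xs, (B T *m u)%R)).
    by apply: measurable_fun_pair => //; exact: measurable_mulmx.
  exact: (measurableT_comp (mg T (ltnSn T)) mxu).
- by move=> u _; rewrite mule_ge0// lee_fin expR_ge0.
- by rewrite lee_fin expR_ge0.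
Qed.

End path_law_integral.

(** * Marginals of path laws *)

Section path_law_marginals.
Context (R : realType) (n m : nat).
Variables (A : nat -> 'M[R]_n) (B : nat -> 'M[R]_(n, m)).
Local Open Scope ereal_scope.
Implicit Types (init : probability 'cV[R]_n R) (K : policy R n m).

(** The default value of [nth] makes this total, without a proof that [k] is at most [T]. *)
Definition path_prefix k T (xs : T.-tuple 'cV[R]_n) : k.-tuple 'cV[R]_n :=
  [tuple nth 0%R xs i | i < k].

Lemma measurable_path_prefix k T : measurable_fun setT (@path_prefix k T).
Proof.
apply/measurable_fun_tnthP => i.
rewrite (_ : _ \o _ = fun xs : T.-tuple 'cV[R]_n => nth 0%R xs i).
  exact: measurable_nth_tuple.
by apply/funext => xs /=; rewrite tnth_mktuple.
Qed.

Lemma path_prefix_id T (xs : T.-tuple 'cV[R]_n) : path_prefix T xs = xs.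
Proof. by apply: eq_from_tnth => i; rewrite tnth_mktuple (tnth_nth 0%R). Qed.

Lemma path_prefix_extend k C p (D : 'M[R]_(n, p)) T (xs : T.+1.-tuple 'cV[R]_n) u :
  (k <= T.+1)%N -> path_prefix k (extend_path C D (xs, u)) = path_prefix k xs.
Proof.
move=> kT; apply: eq_from_tnth => i; rewrite !tnth_mktuple nth_extend_path.
by rewrite (leq_trans (ltn_ord i) kT).
Qed.

(** Later stages do not alter the prefix, and their kernels have total mass one. *)
Lemma ge0_integral_path_prefix init K T k (F : k.+1.-tuple 'cV[R]_n -> \bar R) :
  (k <= T)%N -> measurable_fun setT F -> (forall xs, 0 <= F xs) ->
  \int[path_law A B init K T]_xs F (path_prefix k.+1 xs) =
  \int[path_law A B init K k]_xs F xs.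
Proof.
move=> + mF F0; elim: T => [|T ih] kT.
  by case: k F mF F0 kT => // F mF F0 _; apply: eq_integral => xs _; rewrite path_prefix_id.
have [kE|kneq] := eqVneq k T.+1.
  by subst k; apply: eq_integral => xs _; rewrite path_prefix_id.
have {kT kneq}kT : (k <= T)%N by rewrite -ltnS ltn_neqAle kneq.
have mFp : measurable_fun setT (fun xs : T.+2.-tuple 'cV[R]_n => F (path_prefix k.+1 xs)).
  exact: (measurableT_comp mF (@measurable_path_prefix k.+1 T.+2)).
rewrite (ge0_integral_path_lawS _ _ _ _ mFp (fun xs => F0 _)) -ih//.
apply: eq_integral => xs _.
transitivity (\int[K T (last_state xs)]_u cst (F (path_prefix k.+1 xs)) u).
  by apply: eq_integral => u _; rewrite path_prefix_extend.
by rewrite integral_cst//= prob_kernel mule1.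
Qed.

Lemma ge0_integral_state init K T k (f : 'cV[R]_n -> \bar R) :
  (k <= T)%N -> measurable_fun setT f -> (forall x, 0 <= f x) ->
  \int[path_law A B init K T]_xs f (nth 0%R xs k) =
  \int[path_law A B init K k]_xs f (last_state xs).
Proof.
move=> kT mf f0.
rewrite -(ge0_integral_path_prefix (F := fun xs => f (last_state xs)) _ _ kT)//.
  by apply: eq_integral => xs _; rewrite /last_state tnth_mktuple.
exact: (measurableT_comp mf (@measurable_last_state R n k)).
Qed.

Lemma ge0_integral_increment init K T k (f : 'cV[R]_n -> \bar R) :
  (k < T)%N -> measurable_fun setT f -> (forall x, 0 <= f x) ->
  \int[path_law A B init K T]_xs f (nth 0 xs k.+1 - A k *m nth 0 xs k)%R =
  \int[path_law A B init K k]_xs \int[K k (last_state xs)]_u f (B k *m u)%R.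
Proof.
move=> kT mf f0.
pose F (xs : k.+2.-tuple 'cV[R]_n) := f (nth 0 xs k.+1 - A k *m nth 0 xs k)%R.
have mF : measurable_fun setT F.
  exact: (measurableT_comp mf (@measurable_increment _ _ A _ k)).
transitivity (\int[path_law A B init K T]_xs F (path_prefix k.+2 xs)).
  apply: eq_integral => xs _; rewrite /F.
  have pE i : (i < k.+2)%N -> nth 0%R (path_prefix k.+2 xs) i = nth 0%R xs i.
    by move=> ik; rewrite -(tnth_nth 0%R _ (Ordinal ik)) tnth_mktuple.
  by rewrite !pE.
rewrite ge0_integral_path_prefix//; last by move=> xs; exact: f0.
rewrite (ge0_integral_path_lawS _ _ _ _ mF (fun xs => f0 _)).
apply: eq_integral => xs _; apply: eq_integral => u _; congr f.
have nE := nth_extend_path (A k) (B k) xs u.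
by rewrite !nE ltnn eqxx ltnSn last_stateE addrC addKr.
Qed.

End path_law_marginals.

Lemma ge0_integral_gaussian (R : realType) n (mu : 'cV[R]_n) (S : 'M[R]_n) f :
  measurable_fun setT f -> (forall x, 0%E <= f x)%E ->
  (\int[gaussian mu S]_x f x =
   \int[std_gaussian R n]_z f (mu + cov_factor S *m z)%R)%E.
Proof. by move=> mf f0; rewrite [LHS]ge0_integral_distribution. Qed.

Lemma integral_measure_eq d (T : measurableType d) (R : realType)
    (mu nu : {measure set T -> \bar R}) f :
  mu ≡μ nu -> (\int[mu]_x f x = \int[nu]_x f x)%E.
Proof. by move=> munu; apply: eq_measure_integral => A mA _; exact: munu. Qed.

(** * Gaussian laws of states, inputs and increments *)

Section gaussian_images.
Context (R : realType).
Local Open Scope ereal_scope.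

(** Both densities have the same exponent, and their existentially given constants agree because
    both laws have mass one. Thus [gaussian], built on an arbitrarily chosen factor, can be computed
    with any factor of full row rank. *)
Lemma same_law_gram p q q' (W : 'M[R]_(p, q)) (W' : 'M[R]_(p, q')) :
  row_free W -> row_free W' -> gram W = gram W' ->
  same_law (std_gaussian R q) (std_gaussian R q') (mulmx W) (mulmx W').
Proof.
move=> /ge0_integral_std_gaussian_row_free[c c0 cE].
move=> /ge0_integral_std_gaussian_row_free[c' c'0 c'E] WW' f mf f0.
have ratio : c = c'.
  pose e (x : 'cV[R]_p) := expR (sqnorm x / 2 - qform (invmx (gram W')) x / 2).
  have me : measurable_fun setT (fun x => (e x)%:E).
    apply/measurable_EFinP; have := measurable_gauss_weight (invmx (gram W')) 1.
    by under eq_fun do rewrite mul1r.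
  pose I := \int[std_gaussian R p]_x (e x)%:E.
  have cst1 q0 (V : 'M[R]_(p, q0)) r : (0 < r)%R ->
      (forall f, measurable_fun setT f -> (forall x, 0 <= f x) ->
       \int[std_gaussian R q0]_z f (V *m z)%R =
       \int[std_gaussian R p]_x (f x *
         (r * expR (sqnorm x / 2 - qform (invmx (gram W')) x / 2))%:E)) ->
      r%:E * I = 1.
    move=> r0 /(_ (cst 1) (measurable_cst _) (fun=> lee01)).
    rewrite [in LHS]integral_cst//= probability_setT mule1 => {1}->.
    rewrite /I -ge0_integralZl//.
    - by apply: eq_integral => x _; rewrite mul1e EFinM.
    - by move=> x _; rewrite lee_fin expR_ge0.
    - by rewrite lee_fin ltW.
  rewrite WW' in cE.
  have e1 := cst1 _ _ _ c0 cE; have e2 := cst1 _ _ _ c'0 c'E.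
  have [i iE] : exists i, I = i%:E.
    move: e1; case: (I) => [i _| |]; first by exists i.
      by rewrite gt0_muley// lte_fin.
    by rewrite gt0_muleNy// lte_fin.
  move: e1 e2; rewrite iE -!EFinM => -[e1] [e2].
  have i0 : (i != 0)%R by apply/eqP => i0; move/eqP: e1; rewrite i0 mulr0 eq_sym oner_eq0.
  by apply: (mulIf i0); rewrite e1 e2.
by rewrite (cE _ mf f0) (c'E _ mf f0) ratio WW'.
Qed.

Lemma ge0_integral_gaussian_row_free p q (W : 'M[R]_(p, q)) f : posdef (gram W) ->
  measurable_fun setT f -> (forall x, 0 <= f x) ->
  \int[gaussian 0 (gram W)]_x f x = \int[std_gaussian R q]_z f (W *m z)%R.
Proof.
move=> pW mf f0; rewrite ge0_integral_gaussian//; under eq_integral do rewrite add0r.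
apply: same_law_gram => //; last by rewrite gram_cov_factor.
- exact: row_free_cov_factor.
- exact: row_free_gram.
Qed.

Section controlled_process.
Context (n m T : nat) (A : nat -> 'M[R]_n) (B : nat -> 'M[R]_(n, m)).
Variables (S_ini : 'M[R]_n) (P : nat -> 'M[R]_(m, n)) (S_pi : nat -> 'M[R]_m) (pi : policy R n m).
Hypotheses (S_ini_pos : posdef S_ini) (pi_P0 : in_calP0 T P S_pi pi).
Let law k := path_law A B (gaussian 0 S_ini) pi k.
Let cov k := state_cov A B S_ini P S_pi k.

Lemma ge0_integral_policy k x f : (k < T)%N -> measurable_fun setT f -> (forall u, 0 <= f u) ->
  \int[pi k x]_u f u = \int[std_gaussian R m]_z f (P k *m x + cov_factor (S_pi k) *m z)%R.
Proof.
move=> kT mf f0; have [piE _ _] := pi_P0 kT.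
by rewrite (integral_measure_eq _ (piE x)) ge0_integral_gaussian.
Qed.

(** The covariance may become singular, for instance when [A k + B k *m P k] and [B k] both lose
    rank, so the state is kept as a linear image of a standard Gaussian of growing dimension instead
    of being given a density. *)
Lemma state_law k : (k <= T)%N -> exists q (G : 'M[R]_(n, q)), gram G = cov k /\
  same_law (law k) (std_gaussian R q) (@last_state R n k) (mulmx G).
Proof.
elim: k => [_|k ih kT].
  exists n, (cov_factor S_ini); split; first exact: gram_cov_factor.
  move=> f mf f0; rewrite /law ge0_integral_path_law0//.
    by rewrite ge0_integral_gaussian//; apply: eq_integral => z _; rewrite add0r last_stateE.
  exact: (measurableT_comp mf (@measurable_last_state R n 0)).
have [q [G [GE Glaw]]] := ih (ltnW kT).
have [_ Spos _] := pi_P0 kT.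
(* The accumulated noise passes through the closed-loop matrix, and the fresh policy noise enters
   through [B k]. *)
exists (q + m)%N, (row_mx ((A k + B k *m P k) *m G)%R (B k *m cov_factor (S_pi k))%R).
split; first by rewrite gram_row_mx !gramM GE gram_cov_factor.
move=> f mf f0.
have mfl : measurable_fun setT (fun xs => f (@last_state R n k.+1 xs)).
  exact: (measurableT_comp mf (@measurable_last_state R n k.+1)).
rewrite /law (ge0_integral_path_lawS _ _ _ _ mfl (fun xs => f0 _)).
pose h x := \int[std_gaussian R m]_z
  f (A k *m x + B k *m (P k *m x + cov_factor (S_pi k) *m z))%R.
have mh0 : measurable_fun setT (fun z : 'cV[R]_n * 'cV[R]_m =>
    f (A k *m z.1 + B k *m (P k *m z.1 + cov_factor (S_pi k) *m z.2))%R).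
  apply: (measurableT_comp mf); apply: measurable_addcv.
    exact: (measurableT_comp (measurable_mulmx _)).
  apply: (measurableT_comp (measurable_mulmx _)).
  by apply: measurable_addcv; exact: (measurableT_comp (measurable_mulmx _)).
have mh : measurable_fun setT h.
  exact: (@measurable_fun_fubini_tonelli_F _ _ _ _ _ (std_gaussian R m) _ mh0 (fun z => f0 _)).
transitivity (\int[law k]_xs h (last_state xs)).
  apply: eq_integral => xs _; rewrite /h.
  rewrite -(ge0_integral_policy (last_state xs)
    (f := fun u => f (A k *m last_state xs + B k *m u)%R))//.
    by apply: eq_integral => u _; rewrite last_stateE nth_extend_path ltnn eqxx.
  apply: (measurableT_comp mf); apply: measurable_addcv => //; exact: measurable_mulmx.
rewrite (Glaw h mh); last by move=> x; apply: integral_ge0 => z _; exact: f0.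
rewrite std_gaussian_col_mx; last 2 first.
- exact: (measurableT_comp mf (measurable_mulmx _)).
- by move=> z; exact: f0.
apply: eq_integral => u _; apply: eq_integral => v _; congr f.
by rewrite mul_row_col mulmxDr !mulmxDl !mulmxA addrA.
Qed.

(** The input is a linear image of the noise behind the state and of the policy noise. The latter
    makes its covariance positive definite even when that of the state is singular, so the law is
    identified by its Gram matrix. *)
Lemma input_law k f : (k < T)%N -> measurable_fun setT f -> (forall u, 0 <= f u) ->
  \int[law k]_xs \int[pi k (last_state xs)]_u f u = \int[rho_pi A B S_ini P S_pi k]_u f u.
Proof.
move=> kT mf f0; have [q [G [GE Glaw]]] := state_law (ltnW kT).
have [_ Spos _] := pi_P0 kT.
pose W := row_mx (P k *m G)%R (cov_factor (S_pi k)).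
have WE : gram W = (S_pi k + P k *m cov k *m (P k)^T)%R.
  by rewrite gram_row_mx gramM GE gram_cov_factor// addrC.
have pW : posdef (gram W).
  by rewrite gram_row_mx gram_cov_factor// addrC; exact: posdefD_gram.
rewrite /rho_pi -/(cov k) -WE ge0_integral_gaussian_row_free//.
pose h x := \int[std_gaussian R m]_z f (P k *m x + cov_factor (S_pi k) *m z)%R.
have mh0 : measurable_fun setT (fun z : 'cV[R]_n * 'cV[R]_m =>
    f (P k *m z.1 + cov_factor (S_pi k) *m z.2)%R).
  apply: (measurableT_comp mf).
  by apply: measurable_addcv; exact: (measurableT_comp (measurable_mulmx _)).
have mh : measurable_fun setT h.
  exact: (@measurable_fun_fubini_tonelli_F _ _ _ _ _ (std_gaussian R m) _ mh0 (fun z => f0 _)).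
transitivity (\int[law k]_xs h (last_state xs)).
  by apply: eq_integral => xs _; rewrite (ge0_integral_policy _ kT mf f0).
rewrite (Glaw h mh); last by move=> x; apply: integral_ge0 => z _; exact: f0.
rewrite std_gaussian_col_mx; last 2 first.
- exact: (measurableT_comp mf (measurable_mulmx _)).
- by move=> z; exact: f0.
apply: eq_integral => u _; apply: eq_integral => v _; congr f.
by rewrite mul_row_col mulmxA.
Qed.

Lemma Lfun2_ctrl_state k : (k <= T)%N -> Lfun2_colvec (law T) (fun xs => nth 0%R xs k).
Proof.
move=> kT; have [q [G [_ Glaw]]] := state_law kT.
apply: (Lfun2_same_law (Q := std_gaussian R q) (Y := mulmx G)).
- move=> f mf f0; rewrite /law (ge0_integral_state _ _ _ _ kT mf f0).
  exact: Glaw.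
- exact: measurable_nth_tuple.
- exact: Lfun2_linear_image.
Qed.

Lemma increment_law k : (k < T)%N ->
  same_law (law T) (rho_pi A B S_ini P S_pi k)
    (fun xs => nth 0 xs k.+1 - A k *m nth 0 xs k)%R (mulmx (B k)).
Proof.
move=> kT f mf f0; rewrite /law (ge0_integral_increment _ _ _ _ kT mf f0).
rewrite (input_law (f := fun u => f (B k *m u)%R) kT)//.
exact: (measurableT_comp mf (measurable_mulmx _)).
Qed.

End controlled_process.
End gaussian_images.

(** * The Schroedinger bridge *)

Lemma integrableB_EFin d (T : measurableType d) (R : realType)
    (mu : {measure set T -> \bar R}) (f g : T -> R) :
  mu.-integrable setT (fun t => (f t)%:E) -> mu.-integrable setT (fun t => (g t)%:E) ->
  mu.-integrable setT (fun t => (f t - g t)%:E).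
Proof. by move=> fi gi; exact: (integrableB measurableT fi gi). Qed.

(** * Densities of possibly degenerate Gaussian images *)

Section image_density.
Context (R : realType).
Local Open Scope ereal_scope.

(** Selecting a constant turns an existential statement into a function, so that log-densities can
    be defined and subtracted; with [a] quantified inside, the choice does not depend on the
    mean. *)
Definition log_normalization p q (W : 'M[R]_(p, q)) : R :=
  xget 0%R [set k : R | forall a f, measurable_fun setT f -> (forall x, 0 <= f x) ->
    \int[std_gaussian R q]_z f (a + W *m z)%R =
    \int[std_gaussian R p]_x (f x * (expR (gauss_logdens (invmx (gram W)) k a x))%:E)].

Lemma log_normalizationP p q (W : 'M[R]_(p, q)) a f : row_free W ->
  measurable_fun setT f -> (forall x, 0 <= f x) ->
  \int[std_gaussian R q]_z f (a + W *m z)%R =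
  \int[std_gaussian R p]_x
    (f x * (expR (gauss_logdens (invmx (gram W)) (log_normalization W) a x))%:E).
Proof.
move=> /ge0_integral_gaussian_image[k kE]; rewrite /log_normalization.
by case: xgetP => [k' _ k'E|/(_ k)//]; exact: k'E.
Qed.

Lemma measurable_gauss_logdens n d (T : measurableType d) (Q : 'M[R]_n) k (f g : T -> 'cV[R]_n) :
  measurable_fun setT f -> measurable_fun setT g ->
  measurable_fun setT (fun t => gauss_logdens Q k (f t) (g t)).
Proof.
move=> mf mg; apply: measurable_funB.
  apply: measurable_funD => //; apply: measurable_funM => //.
  exact: (measurableT_comp (@measurable_sqnorm R n)).
apply: measurable_funM => //; apply: (measurableT_comp (measurable_qform Q)).
apply: measurable_addcv => //.
have := measurableT_comp (measurable_mulmx (- 1%:M)%R) mf.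
by congr measurable_fun; apply/funext => t /=; rewrite mulNmx mul1mx.
Qed.

Variables (n m : nat) (B : 'M[R]_(n, m)) (S : 'M[R]_m).

(* Log-density at [B u] of the image by [B] of [N(mu, S)], with respect to the image by
   [col_base B] of the standard Gaussian on ['cV_(\rank B)]: the rank factorization
   [B = col_base B *m row_base B] makes the Gaussian on the middle space nondegenerate. *)
Definition image_logdens (mu : 'cV[R]_m) (y : 'cV[R]_n) : R :=
  let W := (row_base B *m cov_factor S)%R in
  gauss_logdens (invmx (gram W)) (log_normalization W)
    (row_base B *m mu)%R (pinvmx (col_base B) *m y)%R.

Lemma measurable_image_logdens d (T : measurableType d) (f : T -> 'cV[R]_m) (g : T -> 'cV[R]_n) :
  measurable_fun setT f -> measurable_fun setT g ->
  measurable_fun setT (fun t => image_logdens (f t) (g t)).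
Proof.
by move=> mf mg; apply: measurable_gauss_logdens;
  exact: (measurableT_comp (measurable_mulmx _)).
Qed.

Lemma integrable_image_logdens d (T : measurableType d) (P : probability T R)
    (f : T -> 'cV[R]_m) (g : T -> 'cV[R]_n) :
  Lfun2_colvec P f -> Lfun2_colvec P g ->
  P.-integrable setT (fun t => (image_logdens (f t) (g t))%:E).
Proof. by move=> lf lg; apply: integrable_gauss_logdens; exact: Lfun2_colvec_mulmx. Qed.

(** The matrix [row_base B *m cov_factor S] has full row rank, which gives a density on the middle
    space; [pinvmx (col_base B)] recovers the middle vector from its image because [col_base B] has
    full column rank. *)
Lemma ge0_integral_gaussian_mulmx mu f : posdef S ->
  measurable_fun setT f -> (forall y, 0 <= f y) ->
  \int[gaussian mu S]_u f (B *m u)%R =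
  \int[std_gaussian R (\rank B)]_v
    (f (col_base B *m v)%R * (expR (image_logdens mu (col_base B *m v)))%:E).
Proof.
move=> pS mf f0.
have fW : row_free (row_base B *m cov_factor S)%R.
  rewrite /row_free mxrankMfree ?row_base_free ?eq_row_base//.
  exact: row_free_cov_factor.
have mfC : measurable_fun setT (fun v => f (col_base B *m v)%R).
  exact: (measurableT_comp mf (measurable_mulmx _)).
rewrite ge0_integral_gaussian//; last first.
  exact: (measurableT_comp mf (measurable_mulmx _)).
transitivity (\int[std_gaussian R m]_z f (col_base B *m
   (row_base B *m mu + row_base B *m cov_factor S *m z))%R).
  have factor (C : 'M[R]_(n, \rank B)) (D : 'M[R]_(\rank B, m)) (L : 'M[R]_m) z :
    (C *m D *m (mu + L *m z) = C *m (D *m mu + D *m L *m z))%R.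
    by rewrite !mulmxDr !mulmxA.
  by apply: eq_integral => z _; rewrite -factor mulmx_base.
rewrite (log_normalizationP (row_base B *m mu)%R fW mfC (fun v => f0 _)).
apply: eq_integral => v _; rewrite /image_logdens mulmxA.
by rewrite mulVpmx ?mul1mx// col_base_full.
Qed.

End image_density.

(** Both images have a positive density with respect to one reference measure, so the densities can
    be divided. *)
Lemma image_logdens_ratio (R : realType) n m (B : 'M[R]_(n, m)) S S' mu mu' f :
  posdef S -> posdef S' -> measurable_fun setT f -> (forall y, 0 <= f y)%E ->
  (\int[gaussian mu S]_u f (B *m u)%R = \int[gaussian mu' S']_u (f (B *m u)%R *
     (expR (image_logdens B S mu (B *m u) - image_logdens B S' mu' (B *m u)))%:E))%E.
Proof.
move=> pS pS' mf f0; rewrite ge0_integral_gaussian_mulmx//.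
pose f' y := (f y * (expR (image_logdens B S mu y - image_logdens B S' mu' y))%:E)%E.
have mf' : measurable_fun setT f'.
  apply: emeasurable_funM => //; apply/measurable_EFinP; apply: measurableT_comp => //.
  by apply: measurable_funB; exact: measurable_image_logdens.
have f'0 y : (0 <= f' y)%E by rewrite mule_ge0// lee_fin expR_ge0.
rewrite [RHS](ge0_integral_gaussian_mulmx B mu' pS' mf' f'0).
by apply: eq_integral => v _; rewrite /f' -muleA -EFinM -expRD subrK.
Qed.

Lemma integral_open_loop (R : realType) n m (rho : noise R m) k (x : 'cV[R]_n) f :
  (\int[open_loop n rho k x]_u f u = \int[rho k]_u f u)%E.
Proof. exact: eq_measure_integral. Qed.

Section schroedinger_bridge.
Context (R : realType) (n m T : nat).
Variables (A : nat -> 'M[R]_n) (B : nat -> 'M[R]_(n, m)).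
Variables (S_ini S_ref : 'M[R]_n) (mu_ref : 'cV[R]_n).
Hypotheses (S_ini_pos : posdef S_ini) (S_ref_pos : posdef S_ref).
Variables (P : nat -> 'M[R]_(m, n)) (S_pi : nat -> 'M[R]_m) (pi : policy R n m).
Hypothesis pi_P0 : in_calP0 T P S_pi pi.
Local Open Scope ereal_scope.

Let ctrl := ctrlLaw T A B S_ini pi.
Let opt_noise := rho_pi A B S_ini P S_pi.
Let opt_cov k : 'M[R]_m := (S_pi k + P k *m state_cov A B S_ini P S_pi k *m (P k)^T)%R.
Let incr k (x : traj R n T) : 'cV[R]_n := (state k.+1 x - A k *m state k x)%R.

Lemma opt_cov_pos k : (k < T)%N -> posdef (opt_cov k).
Proof.
move=> kT; have [q [G [GE _]]] :=
  @state_law R n m T A B S_ini P S_pi pi S_ini_pos pi_P0 k (ltnW kT).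
by have [_ Spos _] := pi_P0 kT; rewrite /opt_cov -GE -gramM; exact: posdefD_gram.
Qed.

(** Taking the identity matrix for [B] lets the initial laws go through the same density lemma as
    the stages. *)
Definition init_logratio (x : 'cV[R]_n) : R :=
  (image_logdens 1%:M S_ini 0 x - image_logdens 1%:M S_ref mu_ref x)%R.

Definition step_logratio (S : nat -> 'M[R]_m) k (x y : 'cV[R]_n) : R :=
  (image_logdens (B k) (S_pi k) (P k *m x) y - image_logdens (B k) (S k) 0 y)%R.

Definition trajectory_logratio (S : nat -> 'M[R]_m) (x : traj R n T) : R :=
  path_loglik A init_logratio (step_logratio S) x.

Lemma measurable_init_logratio : measurable_fun setT init_logratio.
Proof. by apply: measurable_funB; exact: measurable_image_logdens. Qed.

Lemma measurable_step_logratio S k : measurable_fun setT (fun z => step_logratio S k z.1 z.2).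
Proof.
apply: measurable_funB; apply: measurable_image_logdens => //.
exact: (measurableT_comp (measurable_mulmx _)).
Qed.

Lemma measurable_trajectory_logratio S : measurable_fun setT (trajectory_logratio S).
Proof.
apply: measurable_path_loglik; first exact: measurable_init_logratio.
by move=> k _; exact: measurable_step_logratio.
Qed.

Lemma Lfun2_state k : (k <= T)%N -> Lfun2_colvec ctrl (state k).
Proof. exact: (@Lfun2_ctrl_state R n m T A B S_ini P S_pi pi S_ini_pos pi_P0 k). Qed.

Lemma Lfun2_incr k : (k < T)%N -> Lfun2_colvec ctrl (incr k).
Proof.
move=> kT; apply: Lfun2_colvecB; first exact: Lfun2_state.
by apply: Lfun2_colvec_mulmx; apply: Lfun2_state; exact: ltnW.
Qed.

Lemma integrable_trajectory_logratio S :
  ctrl.-integrable setT (fun x => (trajectory_logratio S x)%:E).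
Proof.
have -> : (fun x => (trajectory_logratio S x)%:E) = (fun x : traj R n T =>
    (init_logratio (state 0 x))%:E +
    \sum_(k <- index_enum 'I_T) (step_logratio S k (state k x) (incr k x))%:E).
  by apply/funext => x; rewrite /trajectory_logratio /path_loglik big_mkord EFinD sumEFin.
apply: integrableD => //.
  by apply: integrableB_EFin; apply: integrable_image_logdens;
    [exact: Lfun2_colvec_cst|exact: Lfun2_state|exact: Lfun2_colvec_cst|exact: Lfun2_state].
apply: integrable_sum => // k _.
apply: integrableB_EFin; apply: integrable_image_logdens.
- by apply: Lfun2_colvec_mulmx; apply: Lfun2_state; exact: ltnW.
- exact: Lfun2_incr.
- exact: Lfun2_colvec_cst.
- exact: Lfun2_incr.
Qed.

Lemma KL_refLaw (rho : noise R m) (S : nat -> 'M[R]_m) (Q : probability (traj R n T) R) :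
  (forall k, (k < T)%N -> posdef (S k) /\ rho k ≡μ gaussian 0 (S k)) ->
  Q ≡μ refLaw T A B mu_ref S_ref rho ->
  KL ctrl Q = \int[ctrl]_x (trajectory_logratio S x)%:E.
Proof.
move=> rhoS QE; apply: KL_density; first exact: measurable_trajectory_logratio.
move=> f mf f0; rewrite (integral_measure_eq _ QE).
apply: path_law_density => //.
- exact: measurable_init_logratio.
- by move=> k _; exact: measurable_step_logratio.
- move=> g mg g0.
  have := image_logdens_ratio 1%:M 0 mu_ref S_ini_pos S_ref_pos mg g0.
  under eq_integral do rewrite mul1mx.
  by move=> ->; apply: eq_integral => x _; rewrite mul1mx.
- move=> k x g kT mg g0; have [Spos rhoE] := rhoS k kT.
  have [piE Spi_pos _] := pi_P0 kT.
  rewrite (integral_measure_eq _ (piE x)) integral_open_loop (integral_measure_eq _ rhoE).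
  exact: image_logdens_ratio.
Qed.

(** Gives a finite expected potential, a term common to all competitors that can then be cancelled
    from comparisons of costs. *)
Lemma integrable_potential : ctrl.-integrable setT (fun x => (potential A B x)%:E).
Proof.
have -> : (fun x => (potential A B x)%:E) = (fun x : traj R n T =>
    \sum_(k <- index_enum 'I_T) (2^-1)%:E * (sqnorm (MPinverse (B k) *m incr k x)%R)%:E).
  apply/funext => x; rewrite /potential big_mkord -sumEFin; apply: eq_bigr => k _.
  rewrite EFinM /wnorm; congr (_ * _%:E).
  have -> (M : 'M[R]_(m, n)) (y : 'cV[R]_n) : ((y^T *m (M^T *m M) *m y) 0 0 = sqnorm (M *m y))%R.
    by rewrite /sqnorm trmx_mul !mulmxA.
  by rewrite sqr_sqrtr// sqnorm_ge0.
apply: integrable_sum => // k _; apply: integrableZl => //.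
by apply: integrable_sqnorm; apply: Lfun2_colvec_mulmx; exact: Lfun2_incr.
Qed.

(* [log d(B# N(0, opt_cov k)) / d(B# N(0, S k))] *)
Definition noise_logratio (S : nat -> 'M[R]_m) k (y : 'cV[R]_n) : R :=
  (image_logdens (B k) (opt_cov k) 0 y - image_logdens (B k) (S k) 0 y)%R.

Lemma measurable_noise_logratio S k : measurable_fun setT (noise_logratio S k).
Proof. by apply: measurable_funB; exact: measurable_image_logdens. Qed.

Lemma integrable_noise_logratio_incr S k : (k < T)%N ->
  ctrl.-integrable setT (fun x => (noise_logratio S k (incr k x))%:E).
Proof.
move=> kT; apply: integrableB_EFin; apply: integrable_image_logdens;
  by [exact: Lfun2_colvec_cst|exact: Lfun2_incr].
Qed.

Lemma integral_noise_logratio_incr S k : (k < T)%N ->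
  \int[ctrl]_x (noise_logratio S k (incr k x))%:E =
  \int[opt_noise k]_u (noise_logratio S k (B k *m u)%R)%:E.
Proof.
move=> kT; apply: (integral_same_law
  (@increment_law R n m T A B S_ini P S_pi pi S_ini_pos pi_P0 k kT)
  (f := fun y => (noise_logratio S k y)%:E)).
by apply/measurable_EFinP; exact: measurable_noise_logratio.
Qed.

Lemma integrable_noise_logratio S k : (k < T)%N ->
  (opt_noise k).-integrable setT (EFin \o (fun u => noise_logratio S k (B k *m u)%R)).
Proof.
have lB : Lfun2_colvec (opt_noise k) (mulmx (B k)).
  apply: Lfun2_colvec_mulmx.
  apply: (Lfun2_same_law (Q := std_gaussian R m) (Y := mulmx (cov_factor (opt_cov k)))) => //.
    move=> f mf f0; rewrite [LHS]ge0_integral_gaussian//.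
    by apply: eq_integral => z _; rewrite add0r.
  exact: Lfun2_linear_image.
move=> kT; apply: integrableB_EFin; apply: integrable_image_logdens => //;
  exact: Lfun2_colvec_cst.
Qed.

(** Gibbs' inequality integrates against [opt_noise], so the density needed is that of the
    competitor relative to it, hence the minus sign. *)
Lemma integral_noise_logratioE S k f : (k < T)%N -> posdef (S k) ->
  measurable_fun setT f -> (forall y, 0 <= f y) ->
  \int[gaussian 0 (S k)]_u f (B k *m u)%R =
  \int[opt_noise k]_u (f (B k *m u)%R * (expR (- noise_logratio S k (B k *m u)))%:E).
Proof.
move=> kT Spos mf f0.
rewrite (image_logdens_ratio (B k) 0 0 Spos (opt_cov_pos kT) mf f0).
by apply: eq_integral => u _; rewrite /noise_logratio [in RHS]opprB.
Qed.

Lemma integral_exp_noise_logratio S k : (k < T)%N -> posdef (S k) ->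
  \int[opt_noise k]_u (expR (- noise_logratio S k (B k *m u)))%:E = 1.
Proof.
move=> kT Spos; have := integral_noise_logratioE kT Spos (measurable_cst 1) (fun=> lee01).
rewrite integral_cst//= probability_setT mule1 => ->.
by apply: eq_integral => u _; rewrite mul1e.
Qed.

(** The initial terms and the log-densities of the policy are common to both ratios and cancel,
    which leaves functions of the increments alone. *)
Lemma trajectory_logratioB S x : (trajectory_logratio S x - trajectory_logratio opt_cov x =
  \sum_(0 <= k < T) noise_logratio S k (incr k x))%R.
Proof.
rewrite /trajectory_logratio /path_loglik opprD addrACA subrr add0r.
rewrite raddf_sum/= -big_split/=; apply: eq_bigr => k _.
by rewrite /step_logratio /noise_logratio; lra.
Qed.

(** Written as a sum so that no extended reals are subtracted; integrability of every term permits
    the splitting. *)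
Lemma KL_gap S :
  \int[ctrl]_x (trajectory_logratio S x)%:E =
  \int[ctrl]_x (trajectory_logratio opt_cov x)%:E +
  \sum_(k < T) \int[opt_noise k]_u (noise_logratio S k (B k *m u)%R)%:E.
Proof.
transitivity (\int[ctrl]_x ((trajectory_logratio opt_cov x)%:E +
    \sum_(k <- index_enum 'I_T) (noise_logratio S k (incr k x))%:E)).
  apply: eq_integral => x _; rewrite sumEFin -EFinD; congr EFin.
  by have := trajectory_logratioB S x; rewrite big_mkord; lra.
rewrite integralD//.
- congr (_ + _); rewrite integral_sum//.
    by apply: eq_bigr => k _; exact: integral_noise_logratio_incr.
  by move=> k; exact: integrable_noise_logratio_incr.
- exact: integrable_trajectory_logratio.
- by apply: integrable_sum => // k _; exact: integrable_noise_logratio_incr.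
Qed.

Lemma calR0_cov (rho : noise R m) : calR0 T rho -> exists S : nat -> 'M[R]_m,
  forall k, (k < T)%N -> posdef (S k) /\ rho k ≡μ gaussian 0 (S k).
Proof.
move=> rhoR.
have /choice[S SP] : forall k, exists S, (k < T)%N -> posdef S /\ rho k ≡μ gaussian 0 S.
  move=> k; have [kT|Tk] := boolP (k < T)%N; last by exists 0%R.
  by have [S SP] := rhoR k kT; exists S.
by exists S.
Qed.

Lemma opt_noise_cov k : (k < T)%N -> posdef (opt_cov k) /\ opt_noise k ≡μ gaussian 0 (opt_cov k).
Proof. by move=> kT; split => //; exact: opt_cov_pos. Qed.

(** By the equality case of Gibbs' inequality, zero gaps give the same law of [B k *m u] under both
    noises, so [path_law_density] applies with log-ratio zero. *)
Lemma refLaw_eq (rho : noise R m) (S : nat -> 'M[R]_m) :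
  (forall k, (k < T)%N -> posdef (S k) /\ rho k ≡μ gaussian 0 (S k)) ->
  (forall k, (k < T)%N -> \int[opt_noise k]_u (noise_logratio S k (B k *m u)%R)%:E = 0) ->
  refLaw T A B mu_ref S_ref rho ≡μ refLaw T A B mu_ref S_ref opt_noise.
Proof.
move=> rhoS gap0 E mE; rewrite -[E]setIT -!integral_indic//.
have mE1 : measurable_fun setT (fun x => (\1_E x)%:E : \bar R).
  by apply/measurable_EFinP; exact: measurable_indic.
rewrite [LHS](@path_law_density R n m A B _ (gaussian mu_ref S_ref) _ (open_loop n opt_noise)
  (fun=> 0%R) (fun _ _ _ => 0%R))//.
- apply: eq_integral => x _; rewrite /path_loglik big1 ?addr0 ?expR0 ?mule1//.
- by move=> f _ _; apply: eq_integral => x _; rewrite expR0 mule1.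
- move=> k x f kT mf f0; under [RHS]eq_integral do rewrite expR0 mule1.
  have [Spos rhoE] := rhoS k kT.
  rewrite integral_open_loop (integral_measure_eq _ rhoE).
  rewrite (integral_noise_logratioE kT Spos mf f0).
  have := gibbs_eq0 (integrable_noise_logratio S kT)
    (integral_exp_noise_logratio kT Spos) (gap0 k kT).
  by apply => //; exact: (measurableT_comp mf (measurable_mulmx _)).
Qed.

Lemma noise_gap_ge0 S k : (k < T)%N -> posdef (S k) ->
  0 <= \int[opt_noise k]_u (noise_logratio S k (B k *m u)%R)%:E.
Proof.
move=> kT Spos.
exact: (gibbs_ge0 (integrable_noise_logratio S kT) (integral_exp_noise_logratio kT Spos)).
Qed.

End schroedinger_bridge.

Theorem theorem27 (R : realType) (n m T : nat) (T_ge1 : (1 <= T)%N)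
    (A : nat -> 'M[R]_n) (B : nat -> 'M[R]_(n, m))
    (S_ini S_fin S_ref : 'M[R]_n) (mu_ref : 'cV[R]_n)
    (S_ini_pos : posdef S_ini) (S_fin_pos : posdef S_fin)
    (S_ref_pos : posdef S_ref)
    (P : nat -> 'M[R]_(m, n)) (S_pi : nat -> 'M[R]_m) (pi : policy R n m)
    (pi_P0 : in_calP0 T P S_pi pi)
    (pi_feasible : couplings S_ini S_fin (ctrlLaw T A B S_ini pi)) :
  let Q_opt := refLaw T A B mu_ref S_ref (rho_pi A B S_ini P S_pi) in
  optimal A B mu_ref S_ref (ctrlLaw T A B S_ini pi) Q_opt /\
  ((forall k, (k < T)%N -> \rank (B k) = m) ->
   forall Q : probability (traj R n T) R,
     optimal A B mu_ref S_ref (ctrlLaw T A B S_ini pi) Q -> Q ≡μ Q_opt).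
Proof.
move=> Q_opt; set ctrl := ctrlLaw T A B S_ini pi.
pose opt_cov k : 'M[R]_m := S_pi k + P k *m state_cov A B S_ini P S_pi k *m (P k)^T.
pose gap S k : \bar R := (\int[rho_pi A B S_ini P S_pi k]_u
  (noise_logratio A B S_ini P S_pi S k (B k *m u))%:E)%E.
have optP k : (k < T)%N -> posdef (opt_cov k) /\
    rho_pi A B S_ini P S_pi k ≡μ gaussian 0 (opt_cov k).
  exact: (opt_noise_cov A B S_ini_pos pi_P0).
have KL_opt := KL_refLaw S_ini_pos S_ref_pos pi_P0 optP (fun E _ => erefl : Q_opt E = _).
(* Finiteness allows this term to be cancelled from an inequality of extended reals in the
   uniqueness part. *)
have KL_opt_fin : KL ctrl Q_opt \is a fin_num.
  rewrite KL_opt; apply: integrable_fin_num => //.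
  exact: integrable_trajectory_logratio.
have KL_gapE (rho : noise R m) (S : nat -> 'M[R]_m) (Q : probability (traj R n T) R) :
    (forall k, (k < T)%N -> posdef (S k) /\ rho k ≡μ gaussian 0 (S k)) ->
    Q ≡μ refLaw T A B mu_ref S_ref rho ->
    (KL ctrl Q = KL ctrl Q_opt + \sum_(k < T) gap S k)%E.
  move=> rhoS QE; rewrite (KL_refLaw S_ini_pos S_ref_pos pi_P0 rhoS QE) KL_opt.
  exact: KL_gap.
have gap_ge0 (rho : noise R m) (S : nat -> 'M[R]_m) :
    (forall k, (k < T)%N -> posdef (S k) /\ rho k ≡μ gaussian 0 (S k)) ->
    forall k : 'I_T, (0 <= gap S k)%E.
  move=> rhoS k.
  exact: (noise_gap_ge0 A B S_ini_pos pi_P0 (ltn_ord k) (rhoS k (ltn_ord k)).1).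
have opt_refLaws : refLaws A B mu_ref S_ref Q_opt.
  by exists (rho_pi A B S_ini P S_pi) => // k kT; exists (opt_cov k); exact: optP.
split.
  split=> // Q' [rho /calR0_cov[S rhoS] QE]; rewrite /cost leeD2r// (KL_gapE _ _ _ rhoS QE).
  by rewrite leeDl// sume_ge0// => k _; exact: gap_ge0 rhoS k.
move=> _ Q [[rho /calR0_cov[S rhoS] QE] Qmin].
have V_fin : ('E_ctrl[potential A B] \is a fin_num)%E.
  rewrite unlock; apply: integrable_fin_num => //.
  exact: (integrable_potential A B S_ini_pos pi_P0).
(* Minimality of [Q] tested at [Q_opt] bounds the sum of the gaps by zero; being nonnegative, they
   all vanish. *)
have := Qmin _ opt_refLaws.
rewrite /cost leeD2rE// (KL_gapE _ _ _ rhoS QE) -[leRHS]adde0 leeD2lE// => gap_le0.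
have gap0 k : (k < T)%N -> gap S k = 0%E.
  move=> kT; apply/eqP; rewrite eq_le (gap_ge0 rho S rhoS (Ordinal kT)) andbT.
  apply: le_trans gap_le0; rewrite (bigD1 (Ordinal kT))//= leeDl// sume_ge0// => j _.
  exact: gap_ge0 rhoS j.
move=> E mE; rewrite (QE E mE).
exact: (refLaw_eq S_ref mu_ref S_ini_pos pi_P0 rhoS gap0 mE).
Qed.
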